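(* Let $k$ be a (commutative) Noetherian ring and let $\{I_G\}$ be a hereditary family of ideals, $I_G\subseteq A_{|G|}=k[x_v\mid v\in V_G]$, indexed by cographs $G$. Then there exists a finite list of cographs $G_i$ such that for every cograph $G$, the ideal $I_G$ is generated by the images of the generators of the ideals $I_{G_i}$ under the maps induced by full embeddings $G_i\hookrightarrow G$. In particular, if $k$ is a field, then for any $q\geq 0$ there exists a finite list of cographs $\{G_{i,q}\}$ such that for every cograph $G$, the $q$-th syzygies of $I_G$ are generated by the $q$-th syzygies of the ideals $I_{G_{i,q}}$ (under the maps induced by full embeddings $G_{i,q}\hookrightarrow G$).
   Context: All graphs are finite and simple. The class of cographs is defined inductively: the single vertex is a cograph, and if $G_1,G_2$ are cographs then so are the disjoint union $G_1\sqcup G_2$ and the edge-complements $\overline{G_1},\overline{G_2}$; equivalently, cographs are the graphs with no induced path $P_4$ on four vertices. A full embedding $G\hookrightarrow G'$ is an injection of vertex sets such that two vertices are adjacent in $G$ if and only if their images are adjacent in $G'$. $V_G$ denotes the vertex set of $G$. A full embedding $\phi:G\hookrightarrow G'$ induces the $k$-algebra map $A_{|G|}\to A_{|G'|}$, $x_v\mapsto x_{\phi(v)}$. A family of ideals $\{I_G\}$, one ideal $I_G\subseteq A_{|G|}$ for each cograph $G$, is hereditary if for every full embedding $G\hookrightarrow G'$ of cographs, the induced map $A_{|G|}\to A_{|G'|}$ restricts to an inclusion $I_G\hookrightarrow I_{G'}$. When $k$ is a field, the syzygy modules of a module over a polynomial ring $k[x_1,\dots,x_m]$ are the terms of a minimal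 free resolution, and the generators of the $q$-th term are identified with a basis of the $k$-vector space $\operatorname{Tor}_q(-,k[x_1,\dots,x_m]/\mathfrak m)$, $\mathfrak m=(x_1,\dots,x_m)$. Thus the last assertion means that $\operatorname{Tor}_q^{A_{|G|}}(I_G,A_{|G|}/\mathfrak m)$ is spanned by the images of the spaces $\operatorname{Tor}_q^{A_{|G_{i,q}|}}(I_{G_{i,q}},A_{|G_{i,q}|}/\mathfrak m)$ under the maps induced by full embeddings, where $\mathfrak m$ is in each case the ideal generated by all the variables. *)

(* Defs.v *)
From HB Require Import structures.
From mathcomp Require Import all_boot all_algebra.
From mathcomp.multinomials Require Import freeg mpoly.

Set Implicit Arguments.
Unset Strict Implicit.
Unset Printing Implicit Defensive.

Import GRing.Theory.
Local Open Scope ring_scope.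

(* Subsets are Prop-valued, so that no decidability is imposed on ideals.
   An ideal of [R] is a submodule of the regular module [R^o]. *)
Definition submodule (R : nzRingType) (V : lmodType R) (S : V -> Prop) : Prop :=
  S 0 /\ forall (a : R) (x y : V), S x -> S y -> S (a *: x + y).

Definition span (R : nzRingType) (V : lmodType R) (S : V -> Prop) (x : V) : Prop :=
  exists2 s : seq (R * V), (forall p, p \in s -> S p.2)
                         & x = \sum_(p <- s) p.1 *: p.2.

Definition ideal (R : comNzRingType) (J : R -> Prop) : Prop :=
  @submodule R R^o J.

Definition ideal_gen (R : comNzRingType) (S : R -> Prop) : R -> Prop :=
  @span R R^o S.

Definition noetherian (R : comNzRingType) : Prop :=
  forall J : R -> Prop, ideal J ->
    exists s : seq R, forall x, J x <-> ideal_gen (fun y => y \in s) x.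

(* [Tor_q^R(M, R/J)], for a submodule [M] of a module [V] and an ideal [J], is
   computed from the functorial free resolution
     ... -> F_1 -> F_0 -> M,    F_q = free module on the set Z_q,
     Z_0 = M,  Z_(q+1) = ker (F_q -> Z_q),
   where F_q -> Z_q sends the basis element [<<z>>] to [z] and the differential
   is F_(q+1) -> Z_(q+1), followed by the inclusion in F_q.  Tensoring with R/J
   turns F_q into F_q / J F_q, whence
     Tor_q = {x in F_q | d x in J F_(q-1)} / (d F_(q+1) + J F_q).
   Z_q is a subset of [res_amb q] and F_q one of [res_amb q.+1]: the formal sums
   all of whose basis elements are in Z_q. *)
Section Tor.
Variables (R : comNzRingType) (V : lmodType R).

Fixpoint res_amb (q : nat) : lmodType R :=
  if q is q'.+1 then {freeg (res_amb q') / R} else V.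

Definition res_d (q : nat) : res_amb q.+1 -> res_amb q := fglift id.
Arguments res_d : clear implicits.

Definition free_on (T : choiceType) (Z : T -> Prop) (x : {freeg T / R}) : Prop :=
  forall z, z \in dom x -> Z z.

Variable M : V -> Prop.

Fixpoint res_syz (q : nat) : res_amb q -> Prop :=
  if q is q'.+1 return res_amb q -> Prop
  then fun x => free_on (@res_syz q') x /\ res_d q' x = 0
  else M.

Definition res_free (q : nat) : res_amb q.+1 -> Prop := free_on (@res_syz q).
Arguments res_free : clear implicits.

Variable J : R -> Prop.

Definition res_ideal_mul (q : nat) : res_amb q.+1 -> Prop :=
  span (fun x => exists a y, [/\ J a, res_free q y & x = a *: y]).
Arguments res_ideal_mul : clear implicits.

Definition tor_cycle (q : nat) : res_amb q.+1 -> Prop :=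
  if q is q'.+1 return res_amb q.+1 -> Prop
  then fun x => res_free q'.+1 x /\ res_ideal_mul q' (res_d q'.+1 x)
  else res_free 0.

Definition tor_boundary (q : nat) (x : res_amb q.+1) : Prop :=
  exists2 y, res_free q.+1 y & res_ideal_mul q (x - res_d q.+1 y).

End Tor.

(* The map of resolutions induced by an additive [f : V -> V'] which is
   semilinear over [phi : R -> R'].  When [phi] maps [J] into [J'] and [f] maps
   [M] into [M'], [res_map f q.+1] induces Tor_q^R(M, R/J) -> Tor_q^R'(M', R'/J'). *)
Fixpoint res_map (R R' : comNzRingType) (V : lmodType R) (V' : lmodType R')
    (phi : R -> R') (f : V -> V') (q : nat) : res_amb V q -> res_amb V' q :=
  if q is q'.+1 return res_amb V q -> res_amb V' q
  then fun x : {freeg (res_amb V q') / R} =>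
         \sum_(z <- dom x) << phi (coeff z x) *g res_map phi f z >>
  else f.

Record graph := Graph {
  vertex :> finType;
  adj : rel vertex;
  adj_sym : ssrbool.symmetric adj;
  adj_irr : irreflexive adj
}.
Arguments adj {g}.

Record embedding (G H : graph) := Embedding {
  emb_fun :> G -> H;
  emb_inj : injective emb_fun;
  emb_adj : forall u v, adj (emb_fun u) (emb_fun v) = adj u v
}.

Definition isomorphic (G H : graph) : Prop :=
  exists f : embedding G H, bijective f.

Definition single_vertex : graph :=
  @Graph unit (fun _ _ => false) (fun _ _ => erefl) (fun _ => erefl).

Section DisjointUnion.
Variables G H : graph.

Definition union_adj : rel (G + H)%type := fun x y =>
  match x, y with
  | inl u, inl v => adj u v
  | inr u, inr v => adj u v
  | _, _ => false
  end.

Lemma union_adj_sym : ssrbool.symmetric union_adj.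
Proof. by case=> u [] v //=; rewrite adj_sym. Qed.

Lemma union_adj_irr : irreflexive union_adj.
Proof. by case=> u /=; rewrite adj_irr. Qed.

Definition disjoint_union : graph := Graph union_adj_sym union_adj_irr.
End DisjointUnion.

Section Complement.
Variable G : graph.

Definition compl_adj : rel G := fun u v => (u != v) && ~~ adj u v.

Lemma compl_adj_sym : ssrbool.symmetric compl_adj.
Proof. by move=> u v; rewrite /compl_adj eq_sym adj_sym. Qed.

Lemma compl_adj_irr : irreflexive compl_adj.
Proof. by move=> u; rewrite /compl_adj eqxx. Qed.

Definition complement : graph := Graph compl_adj_sym compl_adj_irr.
End Complement.

Inductive is_cograph : graph -> Prop :=
| cograph_single : is_cograph single_vertex
| cograph_union G H :
    is_cograph G -> is_cograph H -> is_cograph (disjoint_union G H)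
| cograph_compl G : is_cograph G -> is_cograph (complement G)
| cograph_iso G H : isomorphic G H -> is_cograph G -> is_cograph H.

Record cograph := Cograph {
  cograph_graph :> graph;
  cographP : is_cograph cograph_graph
}.

(* k[x_v | v in G]: the #|G| variables are attached to the vertices by
   [enum_rank]. *)
Definition poly_ring (k : comNzRingType) (G : graph) : comNzRingType :=
  {mpoly k[#|G|]}.

Definition var (k : comNzRingType) (G : graph) (v : G) : poly_ring k G :=
  'X_(enum_rank v).

Definition emb_poly (k : comNzRingType) (G H : graph) (f : embedding G H) :
    poly_ring k G -> poly_ring k H :=
  mmap (@mpolyC _ k) (fun i => var k (f (enum_val i))).

Definition hereditary (k : comNzRingType)
    (I : forall G : cograph, poly_ring k G -> Prop) : Prop :=
  forall (G H : cograph) (f : embedding G H) (x : poly_ring k G),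
    I G x -> I H (emb_poly f x).

Definition var_ideal (k : comNzRingType) (G : graph) : poly_ring k G -> Prop :=
  ideal_gen (fun x => exists v : G, x = var k v).

Section FamilyTor.
Variables (k : comNzRingType) (I : forall G : cograph, poly_ring k G -> Prop).

Definition tor_amb (G : cograph) (q : nat) : lmodType (poly_ring k G) :=
  res_amb (poly_ring k G)^o q.+1.

Definition ideal_tor_cycle (G : cograph) (q : nat) : tor_amb G q -> Prop :=
  @tor_cycle _ (poly_ring k G)^o (@I G) (@var_ideal k G) q.

Definition ideal_tor_boundary (G : cograph) (q : nat) : tor_amb G q -> Prop :=
  @tor_boundary _ (poly_ring k G)^o (@I G) (@var_ideal k G) q.

Definition tor_map (G H : cograph) (f : embedding G H) (q : nat) :
    tor_amb G q -> tor_amb H q :=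
  @res_map _ _ (poly_ring k G)^o (poly_ring k H)^o
    (@emb_poly k G H f) (@emb_poly k G H f) q.+1.

(* Tor_q(I_G, k[x_v | v in G] / (x_v | v in G)) is the k-linear span of the
   classes of the cycles in [S]. *)
Definition tor_spanned_by (G : cograph) (q : nat) (S : tor_amb G q -> Prop) :
    Prop :=
  forall x : tor_amb G q, ideal_tor_cycle x ->
    exists2 s : seq (k * tor_amb G q),
      (forall p, p \in s -> S p.2) &
      ideal_tor_boundary (x - \sum_(p <- s) p.1%:MP *: p.2).

End FamilyTor.

(* Main.v *)
(* A cograph is the leaf set of a binary cotree whose inner nodes say whether the
   two sides are disjoint or completely joined.  By Nash-Williams' argument,
   cotrees with leaves labelled in a well-quasi-order are well-quasi-ordered
   under leaf-order preserving full embeddings.  Such embeddings respect the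
   degree-lexicographic order of monomials, so a Groebner argument applies: in a
   bad sequence of leading terms over a Noetherian ring, some leading coefficient
   is a combination of those of earlier comparable terms.  Hence hereditary ideals
   are finitely generated; and so are hereditary submodules of a module freely
   generated by the images f(z_i), f : L_i -> G, of finitely many elements, once
   the embedding f is recorded in the labels.

   For Tor, choose inductively inside the functorial resolution F the free
   subcomplex P on the orbits of finitely many elements, such that P resolves the
   ideal; the kernels to be generated at each step are hereditary.  Since F and P
   are free resolutions, F contracts onto P, so every cycle of F modulo the
   variables is homologous to one in P, and the cycles in P again form a
   hereditary submodule of a module as above. *)
From Stdlib Require Import Classical ClassicalEpsilon FunctionalExtensionality.
From HB Require Import structures.
From mathcomp Require Import all_boot all_order all_algebra.
From mathcomp.multinomials Require Import freeg mpoly.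
Require Import Defs.

Set Implicit Arguments.
Unset Strict Implicit.
Unset Printing Implicit Defensive.

Import Order.TTheory GRing.Theory.

(** * Well-quasi-orders *)

Definition wqo (X : Type) (le : X -> X -> Prop) : Prop :=
  forall f : nat -> X, exists i j, i < j /\ le (f i) (f j).

Lemma ltn_incr_mono (g : nat -> nat) :
  (forall n, g n < g n.+1) -> {mono g : i j / i < j}.
Proof. by move=> h; apply/leqW_mono/leq_mono; apply: homo_ltn h => ? ? ?; apply: ltn_trans. Qed.

(** Indices without a later comparable term cannot be unbounded, as they would form a bad sequence.
    Past the last of them, every term has a later comparable one, and iteration gives the
    subsequence. *)
Lemma wqo_subseq (X : Type) (le : X -> X -> Prop) :
  (forall x y z, le x y -> le y z -> le x z) -> wqo le ->
  forall f : nat -> X, exists g : nat -> nat,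
    (forall i j, i < j -> g i < g j) /\ (forall i j, i < j -> le (f (g i)) (f (g j))).
Proof.
move=> tr W f.
have [m Hm] : exists m, forall i, m <= i -> exists j, i < j /\ le (f i) (f j).
  apply: NNPP => Hno.
  have next m : exists i, m <= i /\ forall j, i < j -> ~ le (f i) (f j).
    apply: NNPP => H; apply: Hno; exists m => i mi; apply: NNPP => H'.
    by apply: H; exists i; split=> // j ij lij; apply: H'; exists j.
  pose nx m := proj1_sig (constructive_indefinite_description _ (next m)).
  have nxP m : m <= nx m /\ forall j, nx m < j -> ~ le (f (nx m)) (f j).
    exact: (proj2_sig (constructive_indefinite_description _ (next m))).
  pose g := fix g n := if n is n'.+1 then nx (g n').+1 else nx 0.
  have gS n : g n < g n.+1 by case: (nxP (g n).+1).
  have gbad n j : g n < j -> ~ le (f (g n)) (f j).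
    by case: n => [|n]; [case: (nxP 0)|case: (nxP (g n).+1)] => _; apply.
  have [i [j [ij lij]]] := W (f \o g).
  by apply: (gbad i (g j)) => //; rewrite (ltn_incr_mono gS).
(* The guard [m <= i] sits under the existential so that a total choice function can be
   extracted. *)
have next i : exists j, m <= i -> i < j /\ le (f i) (f j).
  have [mi|mi] := boolP (m <= i); last by exists 0.
  by have [j hj] := Hm i mi; exists j => _.
pose nx i := proj1_sig (constructive_indefinite_description _ (next i)).
have nxP i : m <= i -> i < nx i /\ le (f i) (f (nx i)).
  exact: (proj2_sig (constructive_indefinite_description _ (next i))).
pose g := fix g n := if n is n'.+1 then nx (g n') else m.
have gm n : m <= g n.
  by elim: n => //= n IH; have [h _] := nxP _ IH; apply: leq_trans IH (ltnW h).
have gS n : g n < g n.+1 by case: (nxP _ (gm n)).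
exists g; split=> [i j ij|i j]; first by rewrite (ltn_incr_mono gS).
elim: j => // j IH; rewrite ltnS leq_eqVlt => /orP[/eqP ->|ij].
  by case: (nxP _ (gm j)).
by apply: tr (IH ij) _; case: (nxP _ (gm j)).
Qed.

Lemma wqo_nat : wqo leq.
Proof.
move=> f; apply: NNPP => H.
have bad i j : i < j -> f j < f i.
  by move=> ij; rewrite ltnNge; apply/negP => h; apply: H; exists i, j.
have le n : f n + n <= f 0.
  by elim: n => [|n IH]; rewrite ?addn0 // addnS -addSn (leq_trans _ IH) // leq_add2r bad.
by have := le (f 0).+1; rewrite addnS ltnNge leq_addl.
Qed.

(** Pigeonhole on the first [#|F|.+1] terms. *)
Lemma wqo_fin (F : finType) : wqo (@eq F).
Proof.
move=> f; apply: NNPP => H.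
have inj : injective (fun i : 'I_#|F|.+1 => f i).
  move=> i j /= e; apply: val_inj; case: (ltngtP i j) => // l; case: H.
    by exists i, j.
  by exists j, i.
by have := leq_card _ inj; rewrite card_ord ltnn.
Qed.

(** Pass to a subsequence ascending in the first component, then compare second components along
    it. *)
Lemma wqo_prod (X Y : Type) (lx : X -> X -> Prop) (ly : Y -> Y -> Prop) :
  (forall x y z, lx x y -> lx y z -> lx x z) -> wqo lx -> wqo ly ->
  wqo (fun p q : X * Y => lx p.1 q.1 /\ ly p.2 q.2).
Proof.
move=> tr wx wy f; have [g [gm gl]] := wqo_subseq tr wx (fst \o f).
have [i [j [ij l]]] := wy (snd \o f \o g).
by exists (g i), (g j); split; [apply: gm|split=> //; apply: gl].
Qed.

(* Nash-Williams: a bad sequence whose terms are successively of minimal size has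
   well-quasi-ordered immediate subterms. *)
Section MinimalBad.
Variables (X : Type) (le sub : X -> X -> Prop) (size : X -> nat).
Hypothesis sub_size : forall x y, sub x y -> size x < size y.
Hypothesis sub_le : forall x y z, le x y -> sub y z -> le x z.

Definition bad_seq (f : nat -> X) := forall i j, i < j -> ~ le (f i) (f j).

Lemma minimal_bad_seq : ~ wqo le ->
  exists f, bad_seq f /\
    wqo (fun x y : {x : X | exists i, sub x (f i)} => le (proj1_sig x) (proj1_sig y)).
Proof.
move=> nW.
have [f0 bad0] : exists f, bad_seq f.
  apply: NNPP => H; apply: nW => f; apply: NNPP => H'; apply: H; exists f => i j ij l.
  by apply: H'; exists i, j.
pose agree n (f g : nat -> X) := forall i, i < n -> f i = g i.
(* Among the bad sequences that share the first [n] terms of [f], choose one whose term [n] has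
   least size. *)
have step n f : bad_seq f -> exists g, [/\ bad_seq g, agree n f g &
    forall h, bad_seq h -> agree n f h -> size (g n) <= size (h n)].
  move=> bf; apply: NNPP => H.
  have : forall m g, bad_seq g -> agree n f g -> size (g n) = m -> False.
    elim/ltn_ind => m IH g bg ag sg; apply: H; exists g; split=> // h bh ah.
    by rewrite leqNgt; apply/negP; rewrite sg => /IH /(_ h bh ah erefl).
  by move=> /(_ _ f bf (fun _ _ => erefl) erefl).
pose st n f : nat -> X := epsilon (inhabits f) (fun g => bad_seq f -> [/\ bad_seq g, agree n f g &
    forall h, bad_seq h -> agree n f h -> size (g n) <= size (h n)]).
have stP n f : bad_seq f -> [/\ bad_seq (st n f), agree n f (st n f) &
    forall h, bad_seq h -> agree n f h -> size (st n f n) <= size (h n)].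
  move=> bf; apply: (epsilon_spec (inhabits f) (fun g => bad_seq f -> [/\ bad_seq g, agree n f g &
    forall h, bad_seq h -> agree n f h -> size (g n) <= size (h n)])) => //.
  by have [g Hg] := step n f bf; exists g.
pose F := fix F n := if n is n'.+1 then st n (F n') else st 0 f0.
have bF n : bad_seq (F n) by elim: n => [|n IH]; [case: (stP 0 f0)|case: (stP n.+1 _ IH)].
have aF n m i : i < n.+1 -> n <= m -> F n i = F m i.
  move=> lin; elim: m => [|m IH]; first by rewrite leqn0 => /eqP ->.
  rewrite leq_eqVlt => /orP[/eqP -> //|]; rewrite ltnS => nm.
  rewrite IH //; have [_ ag _] := stP m.+1 _ (bF m); apply: ag.
  by rewrite (leq_trans lin).
(* The diagonal: all stages from [n] on share the term [n], so badness and minimality pass to the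
   limit. *)
pose f n := F n n.
have fF n m : n <= m -> f n = F m n by move=> nm; apply: aF.
have bf : bad_seq f.
  by move=> i j ij; rewrite (fF i j (ltnW ij)) /f; apply: bF.
have fmin n h : bad_seq h -> agree n f h -> size (f n) <= size (h n).
  case: n => [|n] bh ah; first by have [_ _] := stP 0 f0 bad0; apply.
  have [_ _] := stP n.+1 _ (bF n); apply=> // i lin.
  by rewrite -(fF i n) //; apply: ah.
exists f; split=> // s.
apply: NNPP => Hs.
have [h0 H0] : exists hk : nat -> nat, forall k, sub (proj1_sig (s k)) (f (hk k)).
  exists (fun k => proj1_sig (constructive_indefinite_description _ (proj2_sig (s k)))) => k.
  exact: (proj2_sig (constructive_indefinite_description _ (proj2_sig (s k)))).
have [k0 k0min] : exists k0, forall k, h0 k0 <= h0 k.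
  apply: NNPP => H.
  have : forall m k, h0 k = m -> False.
    elim/ltn_ind => m IH k hk; apply: H; exists k => k'; rewrite leqNgt; apply/negP.
    by rewrite hk => /IH /(_ k' erefl).
  by move/(_ _ 0 erefl).
(* The first [h0 k0] terms of [f], followed by the subterms [s] from [k0] on. By minimality of
   [h0 k0] and [sub_le], a comparison across the junction would give one inside [f]; yet the term at
   [h0 k0] is smaller than that of [f]. *)
pose h i := if i < h0 k0 then f i else proj1_sig (s (k0 + (i - h0 k0))).
have bh : bad_seq h.
  move=> i j ij; rewrite /h; case: (ltnP j (h0 k0)) => lj.
    by rewrite (ltn_trans ij lj); apply: bf.
  case: (ltnP i (h0 k0)) => li l.
    apply: (bf i (h0 (k0 + (j - h0 k0)))); first exact: leq_trans li (k0min _).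
    by apply: sub_le (H0 _).
  apply: Hs; exists (k0 + (i - h0 k0)), (k0 + (j - h0 k0)); split=> //.
  by rewrite ltn_add2l ltn_sub2r // (leq_ltn_trans li ij).
have := fmin (h0 k0) h bh; rewrite /h ltnn subnn addn0 => /(_ _).
have ag : agree (h0 k0) f h by move=> i li; rewrite /h li.
by move/(_ ag); rewrite leqNgt sub_size.
Qed.

End MinimalBad.

(** * Cographs and cotrees *)

Lemma embedding_ext (G H : graph) (f g : embedding G H) : f =1 g -> f = g.
Proof.
case: f g => f fi fa [g gi ga] /= /functional_extensionality e; subst g.
by f_equal; apply: proof_irrelevance.
Qed.

Definition emb_id (G : graph) : embedding G G :=
  Embedding (fun _ _ => id) (fun _ _ => erefl).

Definition emb_comp (G H K : graph) (g : embedding H K) (f : embedding G H) :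
  embedding G K :=
  Embedding (inj_comp (emb_inj (e := g)) (emb_inj (e := f)))
    (fun u v => etrans (emb_adj g (f u) (f v)) (emb_adj f u v)).

Lemma isomorphic_inv (G H : graph) : isomorphic G H ->
  exists (f : embedding G H) (g : embedding H G), cancel f g /\ cancel g f.
Proof.
move=> [f [g fg gf]].
have ga u v : adj (g u) (g v) = adj u v by rewrite -(emb_adj f) !gf.
by exists f, (Embedding (can_inj gf) ga).
Qed.

Lemma isomorphic_sym (G H : graph) : isomorphic G H -> isomorphic H G.
Proof. by case/isomorphic_inv=> f [g [fg gf]]; exists g; exists f. Qed.

Lemma isomorphic_trans (G H K : graph) :
  isomorphic G H -> isomorphic H K -> isomorphic G K.
Proof. by move=> [f bf] [g bg]; exists (emb_comp g f); apply: bij_comp. Qed.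

Section Combine.
Variables (b : bool) (G H : graph).

(** The disjoint union for [b] false and the join for [b] true, in one form; complementation
    exchanges the two. *)
Definition combine_adj : rel (G + H)%type := fun x y =>
  match x, y with
  | inl u, inl v => adj u v
  | inr u, inr v => adj u v
  | _, _ => b
  end.

Lemma combine_adj_sym : ssrbool.symmetric combine_adj.
Proof. by case=> u [] v //=; rewrite adj_sym. Qed.

Lemma combine_adj_irr : irreflexive combine_adj.
Proof. by case=> u /=; rewrite adj_irr. Qed.

Definition combine : graph := Graph combine_adj_sym combine_adj_irr.

Definition emb_inl : embedding G combine :=
  @Embedding G combine inl (fun _ _ e => let: erefl := e in erefl) (fun _ _ => erefl).

Definition emb_inr : embedding H combine :=
  @Embedding H combine inr (fun _ _ e => let: erefl := e in erefl) (fun _ _ => erefl).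

End Combine.

Definition combine_map (A B A' B' : Type) (f : A -> A') (g : B -> B') (x : A + B) : A' + B' :=
  match x with inl u => inl (f u) | inr v => inr (g v) end.

Section CombineEmb.
Variables (b : bool) (G H G' H' : graph) (f : embedding G G') (g : embedding H H').

Lemma combine_map_inj : injective (combine_map f g).
Proof. by move=> [u|u] [v|v] //= [] /emb_inj ->. Qed.

Lemma combine_map_adj (u v : combine b G H) :
  @adj (combine b G' H') (combine_map f g u) (combine_map f g v) = adj u v.
Proof. by case: u v => u [] v //=; rewrite emb_adj. Qed.

Definition combine_emb : embedding (combine b G H) (combine b G' H') :=
  @Embedding (combine b G H) (combine b G' H') _ combine_map_inj combine_map_adj.

End CombineEmb.

(** Vertices index variables through [enum_rank], so these are the embeddings that respect the term
    order on monomials, see [push_mnm_lt]. *)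
Definition monotone (G H : graph) (f : embedding G H) : Prop :=
  forall u v, enum_rank u < enum_rank v -> enum_rank (f u) < enum_rank (f v).

(* [enum_rank] lists the left summand of a sum first, so on the nested sums used
   as vertex sets below it is the left-to-right order of the leaves of a cotree. *)
Lemma enum_rankE (T : finType) (x : T) : enum_rank x = index x (enum T) :> nat.
Proof.
rewrite -{2}(nth_enum_rank x x) index_uniq ?enum_uniq //.
by rewrite -cardE.
Qed.

Lemma enum_sum (A B : finType) :
  enum {: A + B} = [seq inl x | x <- enum A] ++ [seq inr x | x <- enum B].
Proof. by rewrite !enumT [in LHS]unlock. Qed.

Lemma enum_rank_inl (A B : finType) (x : A) :
  enum_rank (inl x : A + B)%type = enum_rank x :> nat.
Proof.
rewrite !enum_rankE enum_sum index_cat map_f ?mem_enum // index_map //.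
by move=> ? ? [].
Qed.

Lemma enum_rank_inr (A B : finType) (x : B) :
  enum_rank (inr x : A + B)%type = #|A| + enum_rank x :> nat.
Proof.
rewrite !enum_rankE enum_sum index_cat size_map -cardE.
case: ifP => [/mapP[? _] //|_]; rewrite index_map // => ? ? [].
by [].
Qed.

Lemma monotone_inl b (G H : graph) : monotone (emb_inl b G H).
Proof. by move=> u v; rewrite !enum_rank_inl. Qed.

Lemma monotone_inr b (G H : graph) : monotone (emb_inr b G H).
Proof. by move=> u v; rewrite !enum_rank_inr ltn_add2l. Qed.

Lemma monotone_combine b (G H G' H' : graph) (f : embedding G G') (g : embedding H H') :
  monotone f -> monotone g -> monotone (combine_emb b f g).
Proof.
move=> mf mg [u|u] [v|v] /=; rewrite ?enum_rank_inl ?enum_rank_inr ?ltn_add2l.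
- exact: mf.
- by move=> _; apply: leq_trans (ltn_ord _) (leq_addr _ _).
- by move=> l; have := ltn_trans (leq_ltn_trans (leq_addr _ _) l) (ltn_ord _); rewrite ltnn.
- exact: mg.
Qed.

Lemma monotone_comp (G H K : graph) (g : embedding H K) (f : embedding G H) :
  monotone g -> monotone f -> monotone (emb_comp g f).
Proof. by move=> mg mf u v /mf /mg. Qed.

(** * Cotrees and the cographs they represent *)

Inductive cotree : Type := CLeaf | CNode of bool & cotree & cotree.

Fixpoint graph_of (t : cotree) : graph :=
  match t with
  | CLeaf => single_vertex
  | CNode b l r => combine b (graph_of l) (graph_of r)
  end.

Fixpoint flip_cotree (t : cotree) : cotree :=
  if t is CNode b l r then CNode (~~ b) (flip_cotree l) (flip_cotree r) else CLeaf.

Lemma isomorphic_combine b (G H G' H' : graph) :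
  isomorphic G G' -> isomorphic H H' -> isomorphic (combine b G H) (combine b G' H').
Proof.
move=> [f [f' ff' f'f]] [g [g' gg' g'g]]; exists (combine_emb b f g).
by exists (combine_map f' g') => -[] x /=; rewrite ?ff' ?f'f ?gg' ?g'g.
Qed.

Lemma isomorphic_union (G H : graph) : isomorphic (combine false G H) (disjoint_union G H).
Proof.
have a (u v : combine false G H) : @adj (disjoint_union G H) u v = adj u v.
  by case: u v => u [].
by exists (@Embedding (combine false G H) (disjoint_union G H) id (fun _ _ => id) a); exists id.
Qed.

Lemma isomorphic_complement (G H : graph) :
  isomorphic G H -> isomorphic (complement G) (complement H).
Proof.
move=> [f bf].
have a (u v : complement G) : @adj (complement H) (f u) (f v) = adj u v.
  by rewrite /= /compl_adj emb_adj (inj_eq (@emb_inj _ _ f)).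
by exists (@Embedding (complement G) (complement H) f (@emb_inj _ _ f) a).
Qed.

Lemma isomorphic_complement_combine b (G H : graph) :
  isomorphic (combine (~~ b) (complement G) (complement H)) (complement (combine b G H)).
Proof.
have a (u v : combine (~~ b) (complement G) (complement H)) :
  @adj (complement (combine b G H)) u v = adj u v by case: u v => u [].
by exists (@Embedding (combine (~~ b) (complement G) (complement H))
  (complement (combine b G H)) id (fun _ _ => id) a); exists id.
Qed.

Lemma isomorphic_flip t : isomorphic (graph_of (flip_cotree t)) (complement (graph_of t)).
Proof.
elim: t => [|b l IHl r IHr] /=; last first.
  by apply: isomorphic_trans (isomorphic_complement_combine _ _ _); apply: isomorphic_combine.
by exists (@Embedding single_vertex (complement single_vertex) id (fun _ _ => id)
  (fun 'tt 'tt => erefl)); exists id.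
Qed.

Lemma flip_cotreeK : involutive flip_cotree.
Proof. by elim=> //= b l -> r ->; rewrite negbK. Qed.

Lemma isomorphic_flip_compl t : isomorphic (complement (graph_of (flip_cotree t))) (graph_of t).
Proof. by apply: isomorphic_sym; rewrite -{1}(flip_cotreeK t); apply: isomorphic_flip. Qed.

(** A join is the complement of the disjoint union of the complements. The induction therefore
    carries the flipped tree, which represents the complement, along with the tree. *)
Lemma graph_of_cograph t : is_cograph (graph_of t).
Proof.
suff [] : is_cograph (graph_of t) /\ is_cograph (graph_of (flip_cotree t)) by [].
elim: t => [|b l [IHl IHl'] r [IHr IHr']] /=; first by split; constructor.
have U G H : is_cograph G -> is_cograph H -> is_cograph (combine false G H).
  move=> cG cH; apply: cograph_iso (cograph_union cG cH).
  exact/isomorphic_sym/isomorphic_union.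
have J t1 t2 : is_cograph (graph_of (flip_cotree t1)) -> is_cograph (graph_of (flip_cotree t2)) ->
    is_cograph (graph_of (CNode true t1 t2)).
  move=> c1 c2; apply: cograph_iso (isomorphic_flip_compl _) _.
  by apply: cograph_compl; apply: U.
case: b; split=> /=; rewrite ?/(graph_of (CNode true l r)).
- exact: (J l r).
- exact: U.
- exact: U.
- by apply: (J (flip_cotree l) (flip_cotree r)); rewrite flip_cotreeK.
Qed.

Definition cograph_of (t : cotree) : cograph := Cograph (graph_of_cograph t).

Lemma cograph_cotree (G : graph) : is_cograph G -> exists t, isomorphic (graph_of t) G.
Proof.
elim=> [|{}G H _ [t it] _ [s is_]|{}G _ [t it]|{}G H iGH _ [t it]].
- by exists CLeaf; exists (emb_id _); exists id.
- exists (CNode false t s); apply: isomorphic_trans (isomorphic_union _ _).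
  exact: isomorphic_combine.
- exists (flip_cotree t); apply: isomorphic_trans (isomorphic_flip t) _.
  exact: isomorphic_complement.
- by exists t; apply: isomorphic_trans it iGH.
Qed.

(** Nonemptiness serves to recover the index of a generator from its code, and to supply a variable
    that makes a monomial strictly larger. *)
Lemma cograph_inhabited (G : graph) : is_cograph G -> inhabited G.
Proof.
elim=> [|{}G H _ [x] _ _|{}G _ [x]|{}G H [f _] _ [x]]; constructor.
- exact: tt.
- exact: inl x.
- exact: x.
- exact: f x.
Qed.

Definition le_mod (N a b : nat) : Prop := a <= b /\ a = b %[mod N].

Lemma le_mod_trans N a b c : le_mod N a b -> le_mod N b c -> le_mod N a c.
Proof. by move=> [l e] [l' e']; split; [apply: leq_trans l'|rewrite e]. Qed.

Definition labelled : Type := {t : cotree & graph_of t -> nat}.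

(** Residues of labels modulo [N] act as marks that must agree, quotients as exponents that may
    grow. *)
Definition le_labelled N (x y : labelled) : Prop :=
  exists f : embedding (graph_of (projT1 x)) (graph_of (projT1 y)),
    monotone f /\ forall v, le_mod N (projT2 x v) (projT2 y (f v)).

Lemma le_labelled_trans N x y z :
  le_labelled N x y -> le_labelled N y z -> le_labelled N x z.
Proof.
move=> [f [mf lf]] [g [mg lg]]; exists (emb_comp g f); split; first exact: monotone_comp.
by move=> v; apply: le_mod_trans (lf v) (lg (f v)).
Qed.

(** The value on a leaf is a default; the relation [sub] in [wqo_labelled] excludes it. *)
Definition left_sub (x : labelled) : labelled :=
  match x with
  | existT CLeaf m => existT _ CLeaf m
  | existT (CNode b l r) m => existT _ l (fun v => m (inl v))
  end.

Definition right_sub (x : labelled) : labelled :=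
  match x with
  | existT CLeaf m => existT _ CLeaf m
  | existT (CNode b l r) m => existT _ r (fun v => m (inr v))
  end.

Fixpoint cotree_size (t : cotree) : nat :=
  if t is CNode _ l r then (cotree_size l + cotree_size r).+1 else 0.

Definition is_leaf (x : labelled) : bool := if projT1 x is CLeaf then true else false.

(** The finite part holds the type of an inner root, or the mark of a leaf; the number is the label
    of a leaf. The other entries are defaults. *)
Definition root_label N (x : labelled) : (option bool * 'I_N.+1) * nat :=
  match x with
  | existT CLeaf m => ((None, inord (m tt %% N)), m tt)
  | existT (CNode b _ _) _ => ((Some b, ord0), 0)
  end.

(** In a minimal bad sequence, the left and right subtrees are well-quasi-ordered. Two terms with
    equal root type and comparable left and right subtrees are themselves comparable, which
    contradicts badness. *)
Lemma wqo_labelled N : 0 < N -> wqo (le_labelled N).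
Proof.
move=> N0; apply: NNPP => nW.
pose sub x y := ~~ is_leaf y /\ (x = left_sub y \/ x = right_sub y).
pose size (x : labelled) := cotree_size (projT1 x).
have sub_size x y : sub x y -> size x < size y.
  case: y => [[|b l r] m] [] //= _ [->|->]; rewrite /size /= ltnS.
    exact: leq_addr.
  exact: leq_addl.
have sub_self x y : sub x y -> le_labelled N x y.
  case: y => [[|b l r] m] [] //= _ [->|->].
    by exists (emb_inl b _ _); split=> //; apply: monotone_inl.
  by exists (emb_inr b _ _); split=> //; apply: monotone_inr.
have sub_le x y z : le_labelled N x y -> sub y z -> le_labelled N x z.
  by move=> lxy /sub_self; apply: le_labelled_trans.
have [f [bf wf]] := minimal_bad_seq sub_size sub_le nW.
pose rle := fun p q : (option bool * 'I_N.+1) * nat => p.1 = q.1 /\ p.2 <= q.2.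
have wr : wqo rle.
  by apply: wqo_prod (@wqo_fin _) wqo_nat => ? ? ? -> ->.
have tr x y z : rle x y -> rle y z -> rle x z.
  by move=> [e l] [e' l']; split; [rewrite e|apply: leq_trans l'].
(* Along [g] the finite parts of the root labels coincide: either all trees are leaves, or all roots
   are inner nodes of the same type. *)
have [g [gm gl]] := wqo_subseq tr wr (root_label N \o f).
case lf0: (is_leaf (f (g 0))).
  apply: (bf (g 0) (g 1)); first exact: gm.
  have [/=] := gl 0 1 isT; move: lf0.
  case: (f (g 0)) => [[|? ? ?] m] //= _; case: (f (g 1)) => [[|? ? ?] m'] //= [e] l.
  have lt a : a %% N < N.+1 by rewrite ltnS ltnW // ltn_mod.
  exists (emb_id _); split=> // -[] /=; split=> //.
  by move/(congr1 (@nat_of_ord _)): e; rewrite !inordK.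
have nl i : ~~ is_leaf (f (g i)).
  case: i => [|i]; first by rewrite lf0.
  have [/=] := gl 0 i.+1 isT; move: lf0.
  by case: (f (g 0)) => [[|? ? ?] m] //= _; case: (f (g i.+1)) => [[|? ? ?] m'].
have sl i : exists j, sub (left_sub (f (g i))) (f j) by exists (g i); split; [|left].
have sr i : exists j, sub (right_sub (f (g i))) (f j) by exists (g i); split; [|right].
have trs (x y z : {x : labelled | exists i, sub x (f i)}) :
  le_labelled N (proj1_sig x) (proj1_sig y) -> le_labelled N (proj1_sig y) (proj1_sig z) ->
  le_labelled N (proj1_sig x) (proj1_sig z) by apply: le_labelled_trans.
(* Left subtrees ascend along all of [h], so a single good pair of right subtrees suffices. *)
have [h [hm hl]] := wqo_subseq trs wf (fun i => exist _ _ (sl i)).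
have [i [j [ij hr]]] := wf (fun i => exist _ _ (sr (h i))).
have := hl i j ij; rewrite /= in hr *; move=> {}hl.
apply: (bf (g (h i)) (g (h j))); first by apply/gm/hm.
have [/= + _] := gl _ _ (hm _ _ ij); move: (nl (h i)) (nl (h j)) hl hr.
case: (f (g (h i))) => [[|b l r] m] //= _; case: (f (g (h j))) => [[|b' l' r'] m'] //= _.
move=> [e1 [m1 l1]] [e2 [m2 l2]] [eb]; subst b'.
exists (combine_emb b e1 e2); split; first exact: monotone_combine.
by move=> [v|v]; [apply: l1|apply: l2].
Qed.

(** * Semilinear maps and the functorial resolution *)

Local Open Scope ring_scope.

Section Submodule.
Variables (R : nzRingType) (V : lmodType R).
Implicit Types (S P : V -> Prop).

Section Closure.
Variables (P : V -> Prop) (sP : submodule P).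

Lemma submod0 : P 0. Proof. by case: sP. Qed.

Lemma submodD x y : P x -> P y -> P (x + y).
Proof. by case: sP => _ h px py; rewrite -[x]scale1r; apply: h. Qed.

Lemma submodZ a x : P x -> P (a *: x).
Proof. by case: sP => p0 h px; rewrite -[_ *: _]addr0; apply: h. Qed.

Lemma submodN x : P x -> P (- x).
Proof. by rewrite -scaleN1r; apply: submodZ. Qed.

Lemma submodB x y : P x -> P y -> P (x - y).
Proof. by move=> px py; apply: submodD => //; apply: submodN. Qed.

Lemma submod_sum (I : Type) (r : seq I) (Q : pred I) (F : I -> V) :
  (forall i, Q i -> P (F i)) -> P (\sum_(i <- r | Q i) F i).
Proof.
move=> h; elim/big_ind: _ => [||i qi]; [exact: submod0|exact: submodD|exact: h].
Qed.

Lemma submod_sum_seq (I : eqType) (r : seq I) (F : I -> V) :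
  (forall i, i \in r -> P (F i)) -> P (\sum_(i <- r) F i).
Proof. by move=> h; rewrite big_seq; apply: submod_sum. Qed.

End Closure.

Lemma span_submodule S : submodule (span S).
Proof.
split; first by exists [::] => //; rewrite big_nil.
move=> a x y [s hs ->] [t ht ->].
exists ([seq (a * p.1, p.2) | p <- s] ++ t).
  by move=> p; rewrite mem_cat => /orP[/mapP[p' /hs hp' ->]//|/ht].
rewrite big_cat big_map scaler_sumr; congr (_ + _).
by apply: eq_bigr => p _; rewrite scalerA.
Qed.

Lemma span_gen S x : S x -> span S x.
Proof.
move=> sx; exists [:: (1, x)]; last by rewrite big_seq1 scale1r.
by move=> p; rewrite inE => /eqP ->.
Qed.

Lemma span_min S P : submodule P -> (forall x, S x -> P x) -> forall x, span S x -> P x.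
Proof.
move=> sP h x [s hs ->]; apply: submod_sum_seq => // p /hs /h.
exact: submodZ.
Qed.

Lemma span_mono S P x : (forall y, S y -> P y) -> span S x -> span P x.
Proof.
by move=> h; apply: span_min => [|y /h]; [apply: span_submodule|apply: span_gen].
Qed.

End Submodule.

Definition semilinear (R R' : nzRingType) (V : lmodType R) (V' : lmodType R')
    (phi : R -> R') (f : V -> V') : Prop :=
  forall a x y, f (a *: x + y) = phi a *: f x + f y.

Section Semilinear.
Variables (R R' : nzRingType) (V : lmodType R) (V' : lmodType R').
Variables (phi : {rmorphism R -> R'}) (f : V -> V').
Hypothesis sf : semilinear phi f.

Lemma semilin0 : f 0 = 0.
Proof.
have := sf 1 0 0; rewrite rmorph1 !scale1r addr0 => /(congr1 (fun x => x - f 0)).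
by rewrite subrr addrK.
Qed.

Lemma semilinD x y : f (x + y) = f x + f y.
Proof. by have := sf 1 x y; rewrite rmorph1 !scale1r. Qed.

Lemma semilinZ a x : f (a *: x) = phi a *: f x.
Proof. by have := sf a x 0; rewrite semilin0 !addr0. Qed.

Lemma semilinN x : f (- x) = - f x.
Proof. by rewrite -scaleN1r semilinZ rmorphN1 scaleN1r. Qed.

Lemma semilinB x y : f (x - y) = f x - f y.
Proof. by rewrite semilinD semilinN. Qed.

Lemma semilin_sum (I : Type) (r : seq I) (P : pred I) (F : I -> V) :
  f (\sum_(i <- r | P i) F i) = \sum_(i <- r | P i) f (F i).
Proof. exact: (big_morph f semilinD semilin0). Qed.

Lemma semilin_preim (P : V' -> Prop) : submodule P -> submodule (fun x => P (f x)).
Proof.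
move=> sP; split; first by rewrite semilin0; apply: submod0.
by move=> a x y px py; rewrite sf; apply: submodD => //; apply: submodZ.
Qed.

Lemma span_semilin (S : V -> Prop) (P : V' -> Prop) :
  submodule P -> (forall x, S x -> P (f x)) -> forall x, span S x -> P (f x).
Proof. by move=> sP h; apply: span_min => //; apply: semilin_preim. Qed.

End Semilinear.

(** * Free modules and maps determined on a basis *)

Section FreeModule.
Variables (R : nzRingType) (K : choiceType).
Implicit Types (x y : {freeg K / R}) (Z : K -> Prop).

Lemma freegUZ (c : R) (z : K) : << c *g z >> = c *: << z >> :> {freeg K / R}.
Proof. by apply/eqP/freeg_eqP => w; rewrite coeffZ !coeffU mul1r. Qed.

Lemma freegE x : x = \sum_(z <- dom x) coeff z x *: << z >>.
Proof. by rewrite -{1}[x]freeg_sumE; apply: eq_bigr => z _; rewrite -freegUZ. Qed.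

End FreeModule.

Section FreeOn.
Variables (R : comNzRingType) (K : choiceType).
Implicit Types (x y : {freeg K / R}) (Z : K -> Prop).

Lemma free_on_submodule Z : submodule (@free_on R K Z).
Proof.
split=> [z|a x y hx hy z /domD_subset]; first by rewrite dom0.
by rewrite mem_cat => /orP[/domZ_subset /hx|/hy].
Qed.

Lemma free_onU Z z : Z z -> free_on Z (<< z >> : {freeg K / R}).
Proof. by move=> hz w; rewrite domU1 inE => /eqP ->. Qed.

Lemma free_on_span Z x : free_on Z x -> span (fun y => exists2 z, Z z & y = << z >>) x.
Proof.
move=> hx; rewrite [x]freegE; apply: submod_sum_seq; first exact: span_submodule.
move=> z /hx hz; apply: submodZ; first exact: span_submodule.
by apply: span_gen; exists z.
Qed.

Lemma free_on_ind Z (P : {freeg K / R} -> Prop) : submodule P ->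
  (forall z, Z z -> P << z >>) -> forall x, free_on Z x -> P x.
Proof.
move=> sP h x /free_on_span; apply: span_min => // y [z /h hz ->] //.
Qed.

Lemma free_on_mono Z Z' x : (forall z, Z z -> Z' z) -> free_on Z x -> free_on Z' x.
Proof. by move=> h hx z /hx /h. Qed.

Lemma fglift_linear (M : lmodType R) (f : K -> M) :
  semilinear (@idfun R) (fglift f : {freeg K / R} -> M).
Proof.
have add x y : fglift f (x + y) = fglift f x + fglift f y.
  have := lift_is_additive f x (- y); rewrite opprK => ->; congr (_ + _).
  by have := lift_is_additive f 0 y; rewrite sub0r => ->;
     rewrite -{1}(subrr y) lift_is_additive subrr sub0r opprK.
move=> a x y; rewrite add /=; congr (_ + _).
have f0 : fglift f 0 = 0 by apply: (addrI (fglift f 0)); rewrite -add !addr0.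
have [r ->] : exists r : seq (R * K), x = \sum_(p <- r) p.1 *: << p.2 >>.
  by exists [seq (coeff z x, z) | z <- dom x]; rewrite big_map; apply: freegE.
rewrite scaler_sumr !(big_morph _ add f0) scaler_sumr.
by apply: eq_bigr => p _; rewrite scalerA -!freegUZ !liftU scalerA.
Qed.

Lemma semilin_free_eq (R' : comNzRingType) (V : lmodType R') (phi : {rmorphism R -> R'})
    (f g : {freeg K / R} -> V) : semilinear phi f -> semilinear phi g ->
  (forall z, f << z >> = g << z >>) -> f =1 g.
Proof.
move=> sf sg h x; rewrite [x]freegE (semilin_sum sf) (semilin_sum sg).
by apply: eq_bigr => z _; rewrite (semilinZ sf) (semilinZ sg) h.
Qed.

End FreeOn.

(** * Functoriality of the resolution *)

Section ResMap.
Variables (R R' : comNzRingType) (V : lmodType R) (V' : lmodType R').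
Variables (phi : {rmorphism R -> R'}) (f : V -> V').
Hypothesis sf : semilinear phi f.

Lemma res_d_linear (S : comNzRingType) (W : lmodType S) q :
  semilinear idfun (@res_d S W q).
Proof. exact: fglift_linear. Qed.

Lemma res_dU (S : comNzRingType) (W : lmodType S) q (z : res_amb W q) :
  @res_d S W q << z >> = z.
Proof. by rewrite /res_d liftU scale1r. Qed.

(** The defining sum runs over the support of the argument. Zero coefficients contribute nothing, so
    the three sums may all be taken over the union [s] of the supports and compared term by term. *)
Lemma res_mapS_semilinear q : semilinear phi (@res_map _ _ _ _ phi f q.+1).
Proof.
have E (s : seq (res_amb V q)) (x : {freeg (res_amb V q) / R}) :
    uniq s -> {subset dom x <= s} ->
    @res_map _ _ _ _ phi f q.+1 x =
      \sum_(z <- s) << phi (coeff z x) *g @res_map _ _ _ _ phi f q z >>.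
  move=> us sub; rewrite /= [RHS](bigID (fun z => z \in dom x)) /=.
  rewrite [X in _ + X]big1 ?addr0 => [|z nz]; last first.
    by rewrite coeff_outdom // rmorph0 freegU0.
  rewrite -[RHS]big_filter; apply: perm_big; apply: uniq_perm.
  - exact: uniq_dom.
  - exact: filter_uniq.
  - by move=> z; rewrite mem_filter; case: (boolP (z \in dom x)) => // /sub ->.
move=> a x y; set s := undup (dom (a *: x + y) ++ dom x ++ dom y).
have us : uniq s by apply: undup_uniq.
have sub (t : seq (res_amb V q)) : {subset t <= dom (a *: x + y) ++ dom x ++ dom y} ->
  {subset t <= s} by move=> h z /h; rewrite mem_undup.
rewrite !(E s) //; try by apply: sub => z; rewrite !mem_cat => ->; rewrite ?orbT.
rewrite scaler_sumr -big_split /=; apply: eq_bigr => z _.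
by rewrite coeffD coeffZ rmorphD rmorphM -freegUD [in RHS]freegUZ scalerA -freegUZ.
Qed.

Lemma res_map_semilinear q : semilinear phi (@res_map _ _ _ _ phi f q).
Proof. by case: q => [|q]; [apply: sf|apply: res_mapS_semilinear]. Qed.

Lemma res_mapU q (z : res_amb V q) :
  @res_map _ _ _ _ phi f q.+1 << z >> = << @res_map _ _ _ _ phi f q z >>.
Proof. by rewrite /= domU1 big_seq1 coeffU eqxx mulr1 rmorph1. Qed.

Lemma res_map_free q (Z : res_amb V q -> Prop) (Z' : res_amb V' q -> Prop) :
  (forall z, Z z -> Z' (@res_map _ _ _ _ phi f q z)) ->
  forall x, free_on Z x -> free_on Z' (@res_map _ _ _ _ phi f q.+1 x).
Proof.
move=> h.
apply: (@free_on_ind _ _ Z (fun x => free_on Z' (@res_map _ _ _ _ phi f q.+1 x))).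
  exact: (semilin_preim (@res_mapS_semilinear q) (@free_on_submodule _ _ Z')).
by move=> z /h hz; rewrite res_mapU; apply: free_onU.
Qed.

Lemma res_map_d q x :
  @res_d _ _ q (@res_map _ _ _ _ phi f q.+1 x) = @res_map _ _ _ _ phi f q (@res_d _ _ q x).
Proof.
move: x; apply: (@semilin_free_eq _ _ _ _ phi) => [a x y|a x y|z].
- by rewrite res_mapS_semilinear res_d_linear.
- by rewrite res_d_linear res_map_semilinear.
- by rewrite res_mapU !res_dU.
Qed.

Variables (M : V -> Prop) (M' : V' -> Prop).
Hypothesis fM : forall x, M x -> M' (f x).

Lemma res_map_syz q x : @res_syz _ _ M q x -> @res_syz _ _ M' q (@res_map _ _ _ _ phi f q x).
Proof.
elim: q x => [|q IH] x; first exact: fM.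
move=> [fx dx]; split; first exact: res_map_free fx.
by rewrite res_map_d dx (semilin0 (@res_map_semilinear _)).
Qed.

Lemma res_map_res_free q x :
  @res_free _ _ M q x -> @res_free _ _ M' q (@res_map _ _ _ _ phi f q.+1 x).
Proof. by apply: res_map_free; apply: res_map_syz. Qed.

Variables (J : R -> Prop) (J' : R' -> Prop).
Hypothesis phiJ : forall a, J a -> J' (phi a).

Lemma res_map_ideal_mul q x : @res_ideal_mul _ _ M J q x ->
  @res_ideal_mul _ _ M' J' q (@res_map _ _ _ _ phi f q.+1 x).
Proof.
apply: (span_semilin (@res_map_semilinear _)); first exact: span_submodule.
move=> _ [a [y [ja fy ->]]]; apply: span_gen; rewrite (semilinZ (@res_map_semilinear _)).
by do 2!eexists; split; [apply: phiJ ja|apply: res_map_res_free fy|].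
Qed.

Lemma res_map_cycle q x : @tor_cycle _ _ M J q x ->
  @tor_cycle _ _ M' J' q (@res_map _ _ _ _ phi f q.+1 x).
Proof.
case: q x => [|q] x; first exact: res_map_res_free.
move=> [fx dx]; split; first exact: res_map_res_free.
by rewrite res_map_d; apply: res_map_ideal_mul.
Qed.

End ResMap.

(** The composites [chi] and [h] are separate maps subject to pointwise equations, since the map
    induced by a composite embedding agrees with the composite of the induced maps only
    pointwise. *)
Lemma res_map_comp (R R' R'' : comNzRingType) (V : lmodType R) (V' : lmodType R')
    (V'' : lmodType R'') (phi : {rmorphism R -> R'}) (psi : {rmorphism R' -> R''})
    (chi : {rmorphism R -> R''}) (f : V -> V') (g : V' -> V'') (h : V -> V'') :
  semilinear phi f -> semilinear psi g -> semilinear chi h ->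
  (forall a, chi a = psi (phi a)) -> (forall x, h x = g (f x)) ->
  forall q x, res_map chi h x = res_map psi g (@res_map _ _ _ _ phi f q x).
Proof.
move=> sf sg sh cE hE; elim=> [|q IH]; first exact: hE.
apply: (@semilin_free_eq _ _ _ _ chi) => [|a x y|z]; first exact: res_mapS_semilinear.
  by rewrite !res_mapS_semilinear cE.
by rewrite !res_mapU IH.
Qed.

Lemma res_map_id (R : comNzRingType) (V : lmodType R) (phi : {rmorphism R -> R})
    (f : V -> V) : (forall a, phi a = a) -> (forall x, f x = x) ->
  forall q x, @res_map _ _ _ _ phi f q x = x.
Proof.
move=> pE fE; elim=> [|q IH]; first exact: fE.
apply: (@semilin_free_eq _ _ _ _ phi) => [|a x y|z]; first exact: res_mapS_semilinear.
  by rewrite pE.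
by rewrite res_mapU IH.
Qed.

(** * Polynomial rings of graphs *)

Section PushMonomial.
Variables (G H : graph) (f : embedding G H).
Implicit Types (m : 'X_{1..#|G|}).

(** The exponent vector of the image of ['X_[m]] under [emb_poly f], see [emb_polyX]. *)
Definition push_mnm m : 'X_{1..#|H|} :=
  (\sum_(i < #|G|) U_(enum_rank (f (enum_val i))) *+ m i)%MM.

Lemma push_mnm_coef m (w : H) :
  push_mnm m (enum_rank w) = (\sum_(i < #|G|) m i * (f (enum_val i) == w))%N.
Proof.
rewrite mnm_sumE; apply: eq_bigr => i _.
by rewrite mulmnE mnm1E (inj_eq enum_rank_inj) mulnC.
Qed.

Lemma push_mnm_in m (v : G) : push_mnm m (enum_rank (f v)) = m (enum_rank v).
Proof.
rewrite push_mnm_coef (bigD1 (enum_rank v)) //= enum_rankK eqxx muln1 big1 ?addn0 // => i ne.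
rewrite (inj_eq (@emb_inj _ _ f)) -(inj_eq enum_rank_inj) enum_valK (negPf ne).
by rewrite muln0.
Qed.

Lemma push_mnm_out m (w : H) : (forall v, f v <> w) -> push_mnm m (enum_rank w) = 0%N.
Proof.
move=> h; rewrite push_mnm_coef big1 // => i _.
by case: eqP => [/h //|]; rewrite muln0.
Qed.

Lemma mdeg_push m : mdeg (push_mnm m) = mdeg m.
Proof.
rewrite /push_mnm mdeg_sum mdegE; apply: eq_bigr => i _.
by rewrite mdegMn mdeg1 mul1n.
Qed.

End PushMonomial.

Lemma mnm_vertex_eq (G : graph) (m m' : 'X_{1..#|G|}) :
  (forall v : G, m (enum_rank v) = m' (enum_rank v)) -> m = m'.
Proof. by move=> h; apply/mnmP => i; rewrite -(enum_valK i). Qed.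

Lemma push_mnm_cases (G H : graph) (f : embedding G H) (w : H) :
  (exists v, w = f v) \/ (forall v, f v <> w).
Proof.
case: (pickP (fun v => f v == w)) => [v /eqP <-|h]; first by left; exists v.
by right=> v /eqP; rewrite h.
Qed.

Lemma push_mnmD (G H : graph) (f : embedding G H) (m m' : 'X_{1..#|G|}) :
  push_mnm f (m + m')%MM = (push_mnm f m + push_mnm f m')%MM.
Proof.
apply: mnm_vertex_eq => w; case: (push_mnm_cases f w) => [[v ->]|h].
  by rewrite mnmDE !push_mnm_in mnmDE.
by rewrite mnmDE !push_mnm_out.
Qed.

Lemma push_mnmMn (G H : graph) (f : embedding G H) (m : 'X_{1..#|G|}) N :
  push_mnm f (m *+ N)%MM = (push_mnm f m *+ N)%MM.
Proof.
apply: mnm_vertex_eq => w; case: (push_mnm_cases f w) => [[v ->]|h].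
  by rewrite mulmnE !push_mnm_in mulmnE.
by rewrite mulmnE !push_mnm_out.
Qed.

Lemma push_mnm_comp (G H K : graph) (g : embedding H K) (f : embedding G H) m :
  push_mnm (emb_comp g f) m = push_mnm g (push_mnm f m).
Proof.
apply: mnm_vertex_eq => w; case: (push_mnm_cases g w) => [[v ->]|h]; last first.
  by rewrite !push_mnm_out // => v; apply: h.
rewrite push_mnm_in; case: (push_mnm_cases f v) => [[u ->]|h].
  by rewrite -[g (f u)]/(emb_comp g f u) !push_mnm_in.
by rewrite !push_mnm_out // => u /(@emb_inj _ _ g) /h.
Qed.

Lemma push_mnm_id (G : graph) m : push_mnm (emb_id G) m = m.
Proof. by apply: mnm_vertex_eq => w; rewrite -{1}[w]/(emb_id G w) push_mnm_in. Qed.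

(** The order compares degrees first and exponents lexicographically next. Degrees are preserved,
    and the first differing exponent, at [i], is carried to the first differing exponent of the
    images. *)
Lemma push_mnm_lt (G H : graph) (f : embedding G H) (m m' : 'X_{1..#|G|}) :
  monotone f -> (m < m')%O -> (push_mnm f m < push_mnm f m')%O.
Proof.
move=> mf lt; case: (ltngtP (mdeg m) (mdeg m')) => [d|d|d].
- by apply: lt_mdeg_ltmc; rewrite !mdeg_push.
- by move: (lt_trans lt (lt_mdeg_ltmc d)); rewrite ltxx.
have [i eqi lti] := ltmcP d lt; apply/ltmcP; first by rewrite !mdeg_push.
exists (enum_rank (f (enum_val i))) => [j lj|]; last first.
  by rewrite !push_mnm_in !enum_valK.
(* A vertex before the image of [i] is either outside the image of [f], with exponent 0 on both
   sides, or by monotonicity the image of a vertex before [i]. *)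
rewrite -(enum_valK j) in lj *; move: (enum_val j) lj => w.
case: (push_mnm_cases f w) => [[v ->]|h] lj; last by rewrite !push_mnm_out.
rewrite !push_mnm_in; apply: eqi; rewrite -(enum_valK i) ltnNge leq_eqVlt.
apply/negP => /orP[/eqP/val_inj/enum_rank_inj e|/mf l].
  by move: lj; rewrite -e ltnn.
by move: (ltn_trans lj l); rewrite ltnn.
Qed.

Section EmbPoly.
Variable k : comNzRingType.

HB.instance Definition _ (G H : graph) (f : embedding G H) :=
  GRing.RMorphism.copy (@emb_poly k G H f)
    (mmap (@mpolyC _ k) (fun i => var k (f (enum_val i)))).

Lemma emb_polyC (G H : graph) (f : embedding G H) c :
  emb_poly f (c%:MP : poly_ring k G) = c%:MP.
Proof. exact: mmapC. Qed.

Lemma emb_polyX (G H : graph) (f : embedding G H) m :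
  emb_poly f ('X_[m] : poly_ring k G) = 'X_[push_mnm f m].
Proof.
rewrite /emb_poly mmapX /mmap1 /push_mnm (big_morph _ (@mpolyXD _ _) (@mpolyX0 _ _)).
by apply: eq_bigr => i _; rewrite -mpolyXn.
Qed.

Lemma emb_poly_var (G H : graph) (f : embedding G H) (v : G) :
  emb_poly f (var k v) = var k (f v).
Proof. by rewrite /emb_poly /var mmapX mmap1U enum_rankK. Qed.

Lemma mpoly_sumE n (p : {mpoly k[n]}) : p = \sum_(m <- msupp p) (p@_m)%:MP * 'X_[m].
Proof. by rewrite {1}[p]mpolyE; apply: eq_bigr => m _; rewrite mul_mpolyC. Qed.

Lemma poly_sumE (G : graph) (p : poly_ring k G) :
  p = \sum_(m <- msupp p) ((p@_m)%:MP : poly_ring k G) * ('X_[m] : poly_ring k G).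
Proof. exact: mpoly_sumE. Qed.

Lemma poly_rmorph_eq (G : graph) (S : nzRingType) (F F' : {rmorphism poly_ring k G -> S}) :
  (forall c : k, F c%:MP = F' c%:MP) -> (forall m, F 'X_[m] = F' 'X_[m]) -> F =1 F'.
Proof.
move=> hC hX p; rewrite (poly_sumE p) !rmorph_sum.
by apply: eq_bigr => m _; rewrite !rmorphM hC hX.
Qed.

Lemma emb_poly_comp (G H K : graph) (g : embedding H K) (f : embedding G H) p :
  emb_poly (emb_comp g f) (p : poly_ring k G) = emb_poly g (emb_poly f p).
Proof.
move: p; apply: (poly_rmorph_eq (F := @emb_poly k _ _ (emb_comp g f))
  (F' := @emb_poly k _ _ g \o @emb_poly k _ _ f)) => [c|m] /=.
  by rewrite !emb_polyC.
by rewrite !emb_polyX push_mnm_comp.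
Qed.

Lemma emb_poly_id (G : graph) (p : poly_ring k G) : emb_poly (emb_id G) p = p.
Proof.
move: p; apply: (poly_rmorph_eq (F := @emb_poly k _ _ (emb_id G)) (F' := idfun)) => [c|m] /=.
  by rewrite emb_polyC.
by rewrite emb_polyX push_mnm_id.
Qed.

Lemma emb_poly_semilinear (G H : graph) (f : embedding G H) :
  @semilinear _ _ (poly_ring k G)^o (poly_ring k H)^o (emb_poly f) (emb_poly f).
Proof. by move=> a x y; rewrite rmorphD rmorphM. Qed.

Lemma emb_poly_var_ideal (G H : graph) (f : embedding G H) p :
  @var_ideal k G p -> @var_ideal k H (emb_poly f p).
Proof.
apply: (span_semilin (@emb_poly_semilinear _ _ f)); first exact: span_submodule.
by move=> _ [v ->]; apply: span_gen; exists (f v); rewrite emb_poly_var.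
Qed.

(** Every monomial other than 1 is divisible by a variable. Thus scalars may be replaced by their
    constant terms modulo the variables. *)
Lemma poly_sub_const (G : graph) (p : poly_ring k G) :
  @var_ideal k G (p - (p@_0%MM)%:MP : poly_ring k G).
Proof.
have SJ := @span_submodule _ (poly_ring k G)^o (fun x => exists v : G, x = var k v).
rewrite {1 2}[p]mpoly_sumE; elim/big_ind: _ => [|x y hx hy|m _].
- by rewrite mcoeff0 mpolyC0 subr0; apply: (submod0 SJ).
- by rewrite mcoeffD mpolyCD opprD addrACA; apply: (submodD SJ).
have [->|nz] := eqVneq m 0%MM.
  by rewrite mpolyX0 mulr1 mcoeffC eqxx mulr1 subrr; apply: (submod0 SJ).
have [i mi] : exists i, m i != 0%N.
  apply/existsP; apply: contraNT nz => /existsPn h; apply/eqP/mnmP => i.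
  by rewrite mnm0E; apply/eqP; have := h i; rewrite negbK.
rewrite mul_mpolyC mcoeffZ mcoeffX (negPf nz) mulr0 mpolyC0 subr0 -mul_mpolyC.
rewrite -(@submK _ U_(i)%MM m); last by rewrite lep1mP.
rewrite mpolyXD mulrA; apply: (submodZ SJ); apply: span_gen; exists (enum_val i).
by rewrite /var enum_valK.
Qed.

Definition res_mod (G : graph) (q : nat) : lmodType (poly_ring k G) :=
  res_amb (poly_ring k G)^o q.

Definition res_emb (G H : graph) (f : embedding G H) (q : nat) : res_mod G q -> res_mod H q :=
  @res_map _ _ (poly_ring k G)^o (poly_ring k H)^o (emb_poly f) (emb_poly f) q.

Lemma res_emb_semilinear (G H : graph) (f : embedding G H) q :
  semilinear (emb_poly f) (@res_emb _ _ f q).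
Proof. exact: (res_map_semilinear (@emb_poly_semilinear _ _ f)). Qed.

Lemma res_embZ (G H : graph) (f : embedding G H) q a (x : res_mod G q) :
  res_emb f (a *: x) = emb_poly f a *: res_emb f x.
Proof. exact: (semilinZ (@res_emb_semilinear _ _ f q)). Qed.

Lemma res_emb_comp (G H K : graph) (g : embedding H K) (f : embedding G H) q x :
  res_emb (emb_comp g f) x = res_emb g (@res_emb _ _ f q x).
Proof.
apply: res_map_comp; [exact: emb_poly_semilinear..| |].
  exact: emb_poly_comp.
exact: emb_poly_comp.
Qed.

Lemma res_emb_id (G : graph) q x : @res_emb _ _ (emb_id G) q x = x.
Proof. by apply: res_map_id; apply: emb_poly_id. Qed.

End EmbPoly.

(** * Groebner theory *)

(** Finitely many generators of the ideal of all [c i] involve only finitely many indices. Any [m]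
    beyond these works. *)
Lemma noetherian_seq (k : comNzRingType) : noetherian k -> forall c : nat -> k,
  exists m, ideal_gen (fun y => exists i, (i < m)%N /\ y = c i) (c m).
Proof.
move=> nk c.
have [s hs] := nk _ (@span_submodule k k^o (fun y => exists i, y = c i)).
pose J m := ideal_gen (fun y => exists i, (i < m)%N /\ y = c i).
have sJ m : @submodule k k^o (J m) by apply: span_submodule.
have Jmono m n y : (m <= n)%N -> J m y -> J n y.
  by move=> mn; apply: span_mono => _ [i [im ->]]; exists i; rewrite (leq_trans im mn).
have Jc y : ideal_gen (fun y => exists i, y = c i) y -> exists m, J m y.
  case=> t; elim: t y => [|p t IH] y ht ->.
    by exists 0%N; rewrite big_nil; apply: (submod0 (sJ _)).
  have [q qt|m hm] := IH _ _ erefl; first by apply: ht; rewrite inE qt orbT.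
  have [i ei] := ht p (mem_head _ _).
  exists (maxn m i.+1); rewrite big_cons; apply: (submodD (sJ _)).
    apply: (submodZ (sJ _)); apply: span_gen; exists i.
    by rewrite leq_max leqnn orbT.
  by apply: Jmono hm; rewrite leq_maxl.
have [m hm] : exists m, forall y, y \in s -> J m y.
  have : forall y, y \in s -> ideal_gen (fun y => exists i, y = c i) y.
    by move=> y ys; apply/hs; apply: span_gen.
  elim: s {hs} => [|y s IH] h; first by exists 0%N.
  have [|m hm] := IH; first by move=> z zs; apply: h; rewrite inE zs orbT.
  have [n hn] := Jc _ (h y (mem_head _ _)).
  exists (maxn m n) => z; rewrite inE => /orP[/eqP ->|/hm].
    by apply: Jmono hn; rewrite leq_maxr.
  by apply: Jmono; rewrite leq_maxl.
exists m; apply: (span_min (sJ m) hm); apply/hs.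
by apply: span_gen; exists m.
Qed.

(* No linear independence is required: [B G t y] says that the term of
   [res_mod k G q] with code [t] is [y], and several codes may have equal terms.
   A monomial [x^m] acts on codes by adding [m *+ N], and residues of codes modulo
   [N] single out the basis elements. *)
Section Groebner.
Variables (k : comNzRingType) (q N : nat).
Hypothesis (noeth_k : noetherian k) (N_gt0 : (0 < N)%N).
Variable B : forall G : graph, 'X_{1..#|G|} -> res_mod k G q -> Prop.
Hypothesis B_fun : forall G t x y, @B G t x -> @B G t y -> x = y.
Hypothesis B_emb : forall (G H : graph) (f : embedding G H) t x,
  monotone f -> B t x -> B (push_mnm f t) (res_emb f x).
Hypothesis B_mul : forall (G : graph) t x (m : 'X_{1..#|G|}),
  B t x -> B (t + m *+ N)%MM (('X_[m] : poly_ring k G) *: x).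
(** This links the order on labelled cotrees to divisibility of terms. The conclusion also
    constrains [t'] outside the image of [f], where it has to be a multiple of [N]. *)
Hypothesis B_le : forall (G H : graph) (f : embedding G H) t x t' x',
  monotone f -> B t x -> B t' x' ->
  (forall v, le_mod N (t (enum_rank v)) (t' (enum_rank (f v)))) ->
  exists m, t' = (push_mnm f t + m *+ N)%MM.

Local Notation pC G c := (c%:MP : poly_ring k G).

(** Combinations with coefficients in [k] only; multiplication by monomials is absorbed into the
    codes. *)
Inductive below (G : graph) (t : 'X_{1..#|G|}) : res_mod k G q -> Prop :=
| below0 : below t 0
| belowS c s y v : (s < t)%O -> B s y -> below t v -> below t (pC G c *: y + v).

Section Below.
Variable G : graph.
Implicit Types (t : 'X_{1..#|G|}) (x y : res_mod k G q).

Lemma belowD t x y : below t x -> below t y -> below t (x + y).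
Proof.
elim=> [|c s z v st bz _ IH] hy; first by rewrite add0r.
by rewrite -addrA; apply: (belowS _ st bz (IH hy)).
Qed.

Lemma belowZ t c x : below t x -> below t (pC G c *: x).
Proof.
elim=> [|d s z v st bz _ IH]; first by rewrite scaler0; constructor.
by rewrite scalerDr scalerA -mpolyCM; apply: (belowS _ st bz IH).
Qed.

Lemma belowB t x y : below t x -> below t y -> below t (x - y).
Proof.
move=> hx /(belowZ (-1)); rewrite mpolyCN mpolyC1 scaleN1r; exact: belowD.
Qed.

Lemma below_trans t s x : below s x -> (s <= t)%O -> below t x.
Proof.
move=> + st; elim=> [|d r z v rs bz _ IH]; first by constructor.
by apply: (belowS _ (lt_le_trans rs st) bz IH).
Qed.

(** Terms of equal code are equal by [B_fun] and can be merged. The leading coefficient may vanish,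
    as an element can have several representations. *)
Lemma below_lead t x : below t x -> x = 0 \/
  exists s c y v, [/\ (s < t)%O, B s y, below s v & x = pC G c *: y + v].
Proof.
elim=> [|c s y v st By _ [->|[s' [c' [y' [v' [st' By' hv' ->]]]]]]]; first by left.
  by right; exists s, c, y, 0; split=> //; constructor.
right; case: (ltgtP s s') => [l|l|e].
- exists s', c', y', (pC G c *: y + v'); split=> //; last by rewrite addrCA.
  exact: (belowS _ l By hv').
- exists s, c, y, (pC G c' *: y' + v'); split=> //.
  exact: (belowS _ l By' (below_trans hv' (ltW l))).
- rewrite -e in By' hv'; exists s, (c + c'), y, v'; split=> //.
  by rewrite (B_fun By' By) addrA -scalerDl mpolyCD.
Qed.

Lemma below_mul t m x : below t x -> below (t + m *+ N)%MM (('X_[m] : poly_ring k G) *: x).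
Proof.
elim=> [|c s y v st By _ IH]; first by rewrite scaler0; constructor.
rewrite scalerDr scalerA mulrC -scalerA; apply: (belowS _ _ (B_mul m By) IH).
by rewrite ltmc_add2l.
Qed.

End Below.

Lemma below_emb (G H : graph) (f : embedding G H) t x :
  monotone f -> below t x -> below (push_mnm f t) (res_emb f x).
Proof.
move=> mf; elim=> [|c s y v st By _ IH].
  by rewrite (semilin0 (@res_emb_semilinear _ _ _ f q)); constructor.
rewrite (@res_emb_semilinear _ _ _ f q) emb_polyC.
exact: (belowS _ (push_mnm_lt mf st) (B_emb mf By) IH).
Qed.

Lemma bounded_submodule (G : graph) :
  submodule (fun x : res_mod k G q => exists t, below t x).
Proof.
have add x y : (exists t, @below G t x) -> (exists t, @below G t y) ->
    exists t, @below G t (x + y).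
  move=> [t ht] [s hs]; exists (Order.max t s); apply: belowD.
    by apply: below_trans ht _; rewrite le_max lexx.
  by apply: below_trans hs _; rewrite le_max lexx orbT.
have zero : exists t, @below G t 0 by exists 0%MM; constructor.
split=> // a x y hx hy; apply: (add _ _ _ hy); case: hx => t ht.
rewrite (poly_sumE a) scaler_suml; elim/big_rec: _ => [|m z _ IH] //.
apply: (add _ _ _ IH); exists (t + m *+ N)%MM.
by rewrite -scalerA; apply/belowZ/below_mul.
Qed.

Lemma bounded_term (G : cograph) t (y : res_mod k G q) : B t y -> exists s, below s y.
Proof.
move=> By; have [v] := cograph_inhabited (cographP G).
(* The bound in [below] is strict, so the code is raised by one variable. *)
exists (t + U_(enum_rank v))%MM.
rewrite -[y]addr0 -[y]scale1r -mpolyC1; apply: (belowS _ _ By); last by constructor.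
by apply: lt_mdeg_ltmc; rewrite mdegD mdeg1 addn1.
Qed.

Variable S : forall G : cograph, res_mod k G q -> Prop.
Hypothesis S_submodule : forall G, submodule (@S G).
Hypothesis S_emb : forall (G H : cograph) (f : embedding G H) x, S x -> S (res_emb f x).
Hypothesis S_below : forall G x, @S G x -> exists t, below t x.

(** Representations by terms need not be unique, so the leading term is chosen data carried with the
    element. *)
Record lead_elt : Type := LeadElt {
  lead_tree : cotree;
  lead_poly : res_mod k (graph_of lead_tree) q;
  lead_code : 'X_{1..#|graph_of lead_tree|};
  lead_coeff : k;
  lead_term : res_mod k (graph_of lead_tree) q;
  lead_tail : res_mod k (graph_of lead_tree) q }.

Definition lead_ok (e : lead_elt) : Prop :=
  [/\ @S (cograph_of (lead_tree e)) (lead_poly e), B (lead_code e) (lead_term e),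
      below (lead_code e) (lead_tail e)
    & lead_poly e = pC _ (lead_coeff e) *: lead_term e + lead_tail e].

(** Membership is [List.In] because [lead_elt] carries no decidable equality. *)
Definition generated (l : seq lead_elt) (G : graph) : res_mod k G q -> Prop :=
  span (fun y => exists e (f : embedding (graph_of (lead_tree e)) G),
                   List.In e l /\ y = res_emb f (lead_poly e)).

Lemma generated_submodule l (G : graph) : submodule (@generated l G).
Proof. exact: span_submodule. Qed.

(** The coefficients [c] for which a generated element cancels [c] times [y] up to terms below [t].
    For fixed [t] and [y] they form an ideal of [k], which is where the Noetherian hypothesis
    acts. *)
Definition lead_reducible (l : seq lead_elt) (G : graph) t (c : k)
    (y : res_mod k G q) : Prop :=
  exists z w, [/\ @generated l G z, below t w & z = pC G c *: y + w].

Lemma lead_reducible_ideal l G t y :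
  @submodule k k^o (fun c => @lead_reducible l G t c y).
Proof.
have sG := @generated_submodule l G.
split.
  exists 0, 0; split; [exact: (submod0 sG)|by constructor|].
  by rewrite mpolyC0 scale0r addr0.
move=> a c d [z [w [gz bw ez]]] [z' [w' [gz' bw' ez']]].
exists (pC G a *: z + z'), (pC G a *: w + w'); split.
- by apply: (submodD sG) => //; apply: (submodZ sG).
- by apply: belowD => //; apply: belowZ.
- by rewrite ez ez' scalerDr scalerA -mpolyCM addrACA -scalerDl mpolyCD.
Qed.

Lemma generated_sub l (G : cograph) z : (forall e, List.In e l -> lead_ok e) ->
  @generated l G z -> S z.
Proof.
move=> hl; apply: span_min => // _ [e [f [/hl [Se _ _ _] ->]]].
exact: (@S_emb (cograph_of (lead_tree e)) G f).
Qed.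

(** Contrapositive of the division algorithm: if every leading term reduces, well-founded induction
    on the bounding monomial shows that every element is generated. *)
Lemma irreducible_lead l : (forall e, List.In e l -> lead_ok e) ->
  ~ (forall t x, @S (cograph_of t) x -> @generated l (graph_of t) x) ->
  exists e, lead_ok e /\ ~ lead_reducible l (lead_code e) (lead_coeff e) (lead_term e).
Proof.
move=> hl hn; apply: NNPP => H; apply: hn => T x Sx.
have [t bx] := S_below Sx.
have {}H (s : 'X_{1..#|graph_of T|}) c y v : B s y -> below s v ->
    @S (cograph_of T) (pC _ c *: y + v) -> lead_reducible l s c y.
  move=> By bv Sv; apply: NNPP => nr; apply: H.
  by exists (@LeadElt T (pC _ c *: y + v) s c y v).
elim/(@ltmwf #|graph_of T|): t x Sx bx => t IH x Sx bx.
have sG := @generated_submodule l (graph_of T).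
case: (below_lead bx) => [->|[s [c [y [v [st By bv ex]]]]]]; first exact: (submod0 sG).
rewrite ex in Sx *.
have [z [w [gz bw ez]]] := H _ _ _ _ By bv Sx.
(* Subtracting [z] cancels the leading term and leaves [v - w], which lies in [S] and below [s],
   hence under the induction hypothesis. *)
have E : pC _ c *: y + v = z + (v - w) by rewrite ez addrACA subrr addr0.
rewrite E; apply: (submodD sG) => //; apply: (IH s) => //; last exact: belowB.
have -> : v - w = pC _ c *: y + v - z by rewrite E [RHS]addrC addKr.
apply: (submodB (@S_submodule _)) => //; exact: (@generated_sub l (cograph_of T)).
Qed.

(** Otherwise one builds an infinite sequence of elements, each with leading term irreducible by its
    predecessors. The well-quasi-order and the Noetherian property together make one of them
    reducible. *)
Lemma generated_cotree : exists l, (forall e, List.In e l -> lead_ok e) /\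
  forall t x, @S (cograph_of t) x -> @generated l (graph_of t) x.
Proof.
apply: NNPP => H.
have step l : exists e, (forall e, List.In e l -> lead_ok e) ->
    lead_ok e /\ ~ lead_reducible l (lead_code e) (lead_coeff e) (lead_term e).
  case: (classic (forall e, List.In e l -> lead_ok e)) => hl.
    have [|e he] := irreducible_lead hl; last by exists e.
    by move=> h; apply: H; exists l.
  (* For an invalid list any element will do; this only makes the choice function total. *)
  have [|e _] := @irreducible_lead [::] (fun _ => @False_ind _); last by exists e => /hl.
  by move=> h; apply: H; exists [::].
pose nx l := proj1_sig (constructive_indefinite_description _ (step l)).
have nxP l : (forall e, List.In e l -> lead_ok e) -> lead_ok (nx l) /\
    ~ lead_reducible l (lead_code (nx l)) (lead_coeff (nx l)) (lead_term (nx l)).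
  exact: (proj2_sig (constructive_indefinite_description _ (step l))).
pose pre := fix pre n := if n is n'.+1 then nx (pre n') :: pre n' else [::].
pose e n := nx (pre n).
have pre_ok n : forall e, List.In e (pre n) -> lead_ok e.
  elim: n => [|n IH] a //= [<-|/IH //]; by case: (nxP _ IH).
have e_ok n : lead_ok (e n) by case: (nxP _ (pre_ok n)).
have e_irr n : ~ lead_reducible (pre n) (lead_code (e n)) (lead_coeff (e n)) (lead_term (e n)).
  by case: (nxP _ (pre_ok n)).
have e_in i n : (i < n)%N -> List.In (e i) (pre n).
  elim: n => // n IH; rewrite ltnS leq_eqVlt => /orP[/eqP ->|/IH]; by [left|right].
pose lab n : labelled := existT (fun t : cotree => graph_of t -> nat) (lead_tree (e n))
  (fun v => lead_code (e n) (enum_rank v)).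
have [g [gm gl]] := wqo_subseq (@le_labelled_trans N) (wqo_labelled N_gt0) lab.
have [m hm] := noetherian_seq noeth_k (fun i => lead_coeff (e (g i))).
apply: (e_irr (g m)); move: hm.
(* Reducible coefficients form an ideal, so it suffices to treat each earlier coefficient at the
   code of the element [m]. *)
apply: (@span_min k k^o _ _ (lead_reducible_ideal _ _ _)) => _ [i [im ->]].
have [f [mf lf]] := gl i m im; rewrite /= in f mf lf.
have [_ Bi bi Ei] := e_ok (g i); have [_ Bm _ _] := e_ok (g m).
have [d ed] := B_le mf Bi Bm lf.
(* Embedding the element [i] by [f] and multiplying by ['X_[d]] turns its leading term into that of
   the element [m], with its own coefficient, and keeps the tail below. *)
exists (('X_[d] : poly_ring k _) *: res_emb f (lead_poly (e (g i)))),
  (('X_[d] : poly_ring k _) *: res_emb f (lead_tail (e (g i)))); split.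
- apply: (submodZ (generated_submodule _ _)); apply: span_gen; exists (e (g i)), f.
  by split=> //; apply/e_in/gm.
- by rewrite ed; apply/below_mul/below_emb.
- rewrite Ei (@res_emb_semilinear _ _ _ f q) emb_polyC scalerDr scalerA mulrC -scalerA.
  congr (_ *: _ + _); apply: B_fun Bm; rewrite ed.
  exact/B_mul/B_emb.
Qed.

Lemma In_nth (T : Type) (x : T) (l : seq T) : List.In x l ->
  exists i : 'I_(size l), tnth (in_tuple l) i = x.
Proof.
move=> h; suff [i [il e]] : exists i, (i < size l)%N /\ nth x l i = x.
  by exists (Ordinal il); rewrite (tnth_nth x).
elim: l h => //= y l IH [->|/IH [i [il e]]]; first by exists 0%N.
by exists i.+1.
Qed.

(** Every cograph is isomorphic to that of a cotree; an element is moved there, expressed by the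
    generators, and moved back. *)
Theorem finitely_generated : exists (n : nat) (L : 'I_n -> cograph)
    (z : forall i, res_mod k (L i) q),
  (forall i, S (z i)) /\
  forall (G : cograph) x, S x ->
    span (fun y => exists i (f : embedding (L i) G), y = res_emb f (z i)) x.
Proof.
have [l [lok lgen]] := generated_cotree.
exists (size l), (fun i => cograph_of (lead_tree (tnth (in_tuple l) i))),
  (fun i => lead_poly (tnth (in_tuple l) i)); split.
  move=> i; have [|//] := lok (tnth (in_tuple l) i).
  elim: l i {lok lgen} => [|e l IH] [[|i] il] //=; first by left.
  by right; move: (IH (Ordinal (il : (i < size l)%N))); rewrite !(tnth_nth e).
move=> G x Sx; have [t it] := cograph_cotree (cographP G).
have [f [g [fg gf]]] := isomorphic_inv it.
have -> : x = res_emb f (res_emb g x).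
  by rewrite -res_emb_comp (_ : emb_comp f g = emb_id G) ?res_emb_id //; apply: embedding_ext.
apply: (span_semilin (@res_emb_semilinear _ _ _ f q) (span_submodule _) _
  (lgen t _ (@S_emb G (cograph_of t) g _ Sx))) ; move=> y [e [h [ine ->]]].
have [i ei] := In_nth ine; subst e; apply: span_gen; exists i, (emb_comp f h).
by rewrite res_emb_comp.
Qed.

End Groebner.

(** * Contracting a resolution onto a free subcomplex *)

Section Homotopy.
Variables (R : comNzRingType) (V : lmodType R) (M : V -> Prop) (J : R -> Prop).

Local Notation Z q := (@res_syz R V M q).
Local Notation F q := (@res_free R V M q).
Local Notation d q := (@res_d R V q).
Local Notation lin f := (semilinear (@idfun R) f).

Lemma linB (U W : lmodType R) (f g : U -> W) : lin f -> lin g -> lin (fun x => f x - g x).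
Proof. by move=> lf lg a x y; rewrite lf lg opprD addrACA -scalerBr. Qed.

Lemma lin_comp (U W X : lmodType R) (f : W -> X) (g : U -> W) :
  lin f -> lin g -> lin (fun x => f (g x)).
Proof. by move=> lf lg a x y; rewrite lg lf. Qed.

Lemma lin_id (U : lmodType R) : lin (@id U).
Proof. by []. Qed.

Lemma res_dd q x : F q.+1 x -> d q (d q.+1 x) = 0.
Proof.
have l : lin (fun x => d q (d q.+1 x)) by apply: lin_comp; apply: res_d_linear.
apply: (@free_on_ind _ _ (Z q.+1) (fun x => d q (d q.+1 x) = 0)).
  by split=> [|a x' y h h']; rewrite ?(semilin0 l) // l h h' scaler0 addr0.
by move=> z [_ dz]; rewrite res_dU.
Qed.

Lemma res_ideal_mulZ q a y : J a -> F q y -> @res_ideal_mul R V M J q (a *: y).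
Proof. by move=> ja fy; apply: span_gen; exists a, y. Qed.

Lemma res_ideal_mul_submodule q : submodule (@res_ideal_mul R V M J q).
Proof. exact: span_submodule. Qed.

Section Step.
Variables (q : nat) (B : res_amb V q -> Prop) (h' : res_amb V q -> res_amb V q.+1).
Hypotheses (B_syz : forall z, B z -> Z q z) (h'_lin : lin h').
Hypothesis h'P : forall z, Z q z ->
  F q (h' z) /\ exists2 p, free_on B p & d q p = z - d q (h' z).

(* [h] and [h'] are consecutive terms of a contracting homotopy of the resolution
   modulo the subcomplex spanned by the basis elements in [B]. *)
Lemma homotopy_step : exists h : res_amb V q.+1 -> res_amb V q.+2,
  [/\ lin h, forall x, F q x -> F q.+1 (h x)
    & forall x, F q x -> free_on B (x - d q.+1 (h x) - h' (d q x))].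
Proof.
have ex z : exists p, Z q z -> free_on B p /\ d q p = z - d q (h' z).
  case: (classic (Z q z)) => hz; last by exists 0.
  by have [_ [p bp dp]] := h'P hz; exists p.
pose c z := proj1_sig (constructive_indefinite_description _ (ex z)).
have cP z : Z q z -> free_on B (c z) /\ d q (c z) = z - d q (h' z).
  exact: (proj2_sig (constructive_indefinite_description _ (ex z))).
have Bsub := @free_on_submodule R _ B.
(* The inner combination is a cycle: [c z] and [<< z >> - h' z] have the same differential
   [z - d q (h' z)]. Hence it is itself a basis element one degree higher. *)
pose h : res_amb V q.+1 -> res_amb V q.+2 :=
  fglift (fun z : res_amb V q => << (<< z >> - h' z - c z : res_amb V q.+1) >>).
have lh : lin h by apply: fglift_linear.
have hU z : h << z >> = << (<< z >> - h' z - c z : res_amb V q.+1) >>.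
  by rewrite /h liftU scale1r.
have ld := @res_d_linear R V q.
exists h; split=> //.
- apply: (@free_on_ind _ _ (Z q) (fun x => F q.+1 (h x))).
    exact: (semilin_preim lh (@free_on_submodule _ _ _)).
  move=> z hz; rewrite hU; apply: free_onU; have [bc dc] := cP z hz; have [fh _] := h'P hz.
  split.
    apply: (submodB (@free_on_submodule _ _ _)); last exact: free_on_mono bc.
    by apply: (submodB (@free_on_submodule _ _ _)) => //; apply: free_onU.
  by rewrite !(semilinB ld) dc res_dU subrr.
- apply: (@free_on_ind _ _ (Z q) (fun x => free_on B (x - d q.+1 (h x) - h' (d q x)))).
    have lk : lin (fun x => x - d q.+1 (h x) - h' (d q x)).
      apply: linB; last exact: lin_comp.
      apply: linB; first exact: lin_id.
      by apply: lin_comp => //; apply: res_d_linear.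
    exact: (semilin_preim lk Bsub).
  (* On the basis element of [z] the remainder is exactly [c z]. *)
  move=> z hz; rewrite hU !res_dU; have [bc _] := cP z hz.
  by rewrite opprB addrCA subKr addrK.
Qed.

End Step.

(** Take for [p] the remainder of the homotopy. Then [x - p] is the boundary of [h x] plus
    [h' (d q x)], and the latter vanishes modulo [J]. *)
Lemma cycle_homotopy q (B : res_amb V q -> Prop) (h' : res_amb V q -> res_amb V q.+1)
    (h : res_amb V q.+1 -> res_amb V q.+2) :
  (forall x, F q x -> F q.+1 (h x)) ->
  (forall x, F q x -> free_on B (x - d q.+1 (h x) - h' (d q x))) ->
  (forall x, @tor_cycle R V M J q x -> @res_ideal_mul R V M J q (h' (d q x))) ->
  forall x, @tor_cycle R V M J q x ->
    exists2 p, free_on B p & @tor_boundary R V M J q (x - p).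
Proof.
move=> hF hB hJ x cx.
have fx : F q x by case: q B h' h hF hB hJ x cx => [|q] B h' h hF hB hJ x //; case.
exists (x - d q.+1 (h x) - h' (d q x)); first exact: hB.
exists (h x); first exact: hF.
by rewrite opprB addrCA subKr addrK; apply: hJ.
Qed.

Lemma lin_ideal_mul q (h : res_amb V q.+1 -> res_amb V q.+2) : lin h ->
  (forall x, F q x -> F q.+1 (h x)) ->
  forall x, @res_ideal_mul R V M J q x -> @res_ideal_mul R V M J q.+1 (h x).
Proof.
move=> lh hF; apply: (span_semilin lh); first exact: span_submodule.
move=> _ [a [y [ja fy ->]]]; rewrite (semilinZ lh); apply: res_ideal_mulZ => //.
exact: hF.
Qed.

Lemma res_d_ideal_mul q x : @res_ideal_mul R V M J q.+1 x ->
  @res_ideal_mul R V M J q (d q.+1 x).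
Proof.
apply: (span_semilin (@res_d_linear R V q.+1)); first exact: span_submodule.
move=> _ [a [y [ja fy ->]]]; rewrite (semilinZ (@res_d_linear R V q.+1)).
apply: res_ideal_mulZ => //; move: y fy.
apply: (@free_on_ind _ _ (Z q.+1) (fun y => F q (d q.+1 y))).
  exact: (semilin_preim (@res_d_linear R V q.+1) (@free_on_submodule _ _ _)).
by move=> z [fz _]; rewrite res_dU.
Qed.

Lemma res_ideal_mul_free q x : @res_ideal_mul R V M J q x -> F q x.
Proof.
apply: span_min; first exact: free_on_submodule.
by move=> _ [a [y [_ fy ->]]]; apply: (submodZ (@free_on_submodule _ _ _)).
Qed.

(** The differential squares to zero and preserves multiples of [J]. *)
Lemma boundary_cycle q x : @tor_boundary R V M J q x -> @tor_cycle R V M J q x.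
Proof.
move=> [y fy jy].
have lift : submodule (F q) := @free_on_submodule _ _ _.
have dF : F q (d q.+1 y).
  move: y fy {jy}; apply: (@free_on_ind _ _ (Z q.+1) (fun y => F q (d q.+1 y))).
    exact: (semilin_preim (@res_d_linear R V q.+1) (@free_on_submodule _ _ _)).
  by move=> z [fz _]; rewrite res_dU.
have fx : F q x.
  by rewrite -(subrK (d q.+1 y) x); apply: (submodD lift) => //; apply: res_ideal_mul_free.
case: q x y fy jy dF fx lift => [|q] x y fy jy dF fx lift //; split=> //.
have := res_d_ideal_mul jy.
by rewrite (semilinB (@res_d_linear R V q.+1)) (res_dd fy) subr0.
Qed.

Lemma tor_cycle_submodule q : submodule (@tor_cycle R V M J q).
Proof.
case: q => [|q]; first exact: free_on_submodule.
have S := semilin_preim (@res_d_linear R V q.+1) (@res_ideal_mul_submodule q).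
split; first by split; [apply: submod0 (@free_on_submodule _ _ _)|apply: (submod0 S)].
move=> a x y [fx cx] [fy cy]; split; last by case: S => _; apply.
by case: (@free_on_submodule R (res_amb V q.+1) (Z q.+1)) => _; apply.
Qed.

End Homotopy.

(** * Finite generation of ideals and of Tor *)

(** On the image of [f] the difference of exponents is a nonnegative multiple of [N]; elsewhere the
    pushed exponent is 0. The witness divides these differences by [N]. *)
Lemma push_mnm_quotient (G H : graph) (f : embedding G H) N
    (t : 'X_{1..#|G|}) (t' : 'X_{1..#|H|}) :
  (forall v, le_mod N (t (enum_rank v)) (t' (enum_rank (f v)))) ->
  (forall w, (forall v, f v <> w) -> (N %| t' (enum_rank w))%N) ->
  exists m, t' = (push_mnm f t + m *+ N)%MM.
Proof.
move=> hin hout; exists [multinom ((t' i - push_mnm f t i) %/ N)%N | i < #|H|].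
apply: mnm_vertex_eq => w; rewrite mnmDE mulmnE mnmE.
case: (push_mnm_cases f w) => [[v ->]|h].
  rewrite push_mnm_in; have [l e] := hin v.
  by rewrite divnK ?subnKC // -eqn_mod_dvd // e.
by rewrite push_mnm_out // subn0 add0n divnK // hout.
Qed.

Definition orbit (k : comNzRingType) (q n : nat) (L : 'I_n -> cograph)
    (z : forall i, res_mod k (L i) q) (G : graph) (y : res_mod k G q) : Prop :=
  exists i (f : embedding (L i) G), y = res_emb f (z i).

Lemma orbit_emb (k : comNzRingType) (q n : nat) (L : 'I_n -> cograph)
    (z : forall i, res_mod k (L i) q) (G H : graph) (f : embedding G H) y :
  orbit z y -> orbit z (res_emb f y).
Proof. by move=> [i [g ->]]; exists i, (emb_comp f g); rewrite res_emb_comp. Qed.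

(** * Terms of the free module on an orbit *)

Section ModuleTerms.
Variables (k : comNzRingType) (q n : nat) (L : 'I_n -> cograph).
Variable z : forall i, res_mod k (L i) q.

Local Notation mark := {i : 'I_n & L i}.
Local Notation tagm i u := (Tagged (fun i : 'I_n => vertex (L i)) (i := i) u).
Local Notation N := (#|{: mark}|.+1).

(* Codes lie in [0, N), with 0 for an unmarked vertex.  As [L i] is not empty, the
   code determines both [i] and [f]. *)
Definition code (i : 'I_n) (G : graph) (f : embedding (L i) G) : 'X_{1..#|G|} :=
  [multinom if [pick u | f u == enum_val j] is Some u
            then (enum_rank (tagm i u)).+1 else 0%N | j < #|G|].

Lemma code_in i (G : graph) (f : embedding (L i) G) u :
  code f (enum_rank (f u)) = (enum_rank (tagm i u)).+1.
Proof.
rewrite mnmE enum_rankK; case: pickP => [v /eqP/emb_inj ->//|/(_ u)].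
by rewrite eqxx.
Qed.

Lemma code_out i (G : graph) (f : embedding (L i) G) w :
  (forall u, f u <> w) -> code f (enum_rank w) = 0%N.
Proof. by move=> h; rewrite mnmE enum_rankK; case: pickP => // v /eqP/h. Qed.

Lemma code_lt i (G : graph) (f : embedding (L i) G) j : (code f j < N)%N.
Proof. by rewrite mnmE; case: pickP => // u _; rewrite ltnS ltn_ord. Qed.

Lemma code_mod i (G : graph) (f : embedding (L i) G) m j :
  ((code f + m *+ N)%MM j %% N)%N = code f j.
Proof. by rewrite mnmDE mulmnE addnC modnMDl modn_small ?code_lt. Qed.

Lemma code_push i (G H : graph) (g : embedding G H) (f : embedding (L i) G) :
  push_mnm g (code f) = code (emb_comp g f).
Proof.
apply: mnm_vertex_eq => w; case: (push_mnm_cases g w) => [[v ->]|h]; last first.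
  by rewrite push_mnm_out // code_out // => u; apply: h.
rewrite push_mnm_in; case: (push_mnm_cases f v) => [[u ->]|h].
  by rewrite code_in -[g (f u)]/(emb_comp g f u) code_in.
by rewrite !code_out // => u /(@emb_inj _ _ g)/h.
Qed.

(** Marks are nonzero and occur only on the image of an embedding, so an equal mark puts [w] in the
    image of [g] and identifies its preimage. *)
Lemma code_match i j (G H : graph) (f : embedding (L i) G) (g : embedding (L j) H) u w :
  code g (enum_rank w) = code f (enum_rank (f u)) ->
  exists u', w = g u' /\ tagm i u = tagm j u'.
Proof.
rewrite code_in; case: (push_mnm_cases g w) => [[u' ->]|h]; last by rewrite code_out.
by rewrite code_in => -[] /val_inj/enum_rank_inj <-; exists u'.
Qed.

Lemma tagm_inj i (u v : L i) : tagm i u = tagm i v -> u = v.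
Proof. by move/eqP; rewrite eq_Tagged => /eqP. Qed.

(** Residues of the exponents store the embedding [f], quotients store the monomial [m]; a term of
    the module thus becomes a single monomial. *)
Definition module_term (G : graph) (t : 'X_{1..#|G|}) (x : res_mod k G q.+1) : Prop :=
  exists i (f : embedding (L i) G) m, t = (code f + m *+ N)%MM /\
    x = ('X_[m] : poly_ring k G) *: (<< res_emb f (z i) >> : res_mod k G q.+1).

(** Residues give back the marks, one mark gives [i], all of them give [f], and the quotients then
    give [m]. *)
Lemma module_term_fun G t x y : @module_term G t x -> @module_term G t y -> x = y.
Proof.
move=> [i [f [m [et ->]]]] [j [g [m' [et' ->]]]].
have cE a : code f a = code g a by rewrite -(code_mod f m) -(code_mod g m') -et -et'.
have [u0] := cograph_inhabited (cographP (L i)).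
have [_ [_ /(congr1 (@tag _ _)) /= eij]] := code_match (esym (cE (enum_rank (f u0)))).
subst j; have efg : f = g.
  apply: embedding_ext => u.
  by have [u' [-> /tagm_inj ->]] := code_match (esym (cE (enum_rank (f u)))).
subst g; suff -> : m = m' by [].
apply/mnmP => a; move/mnmP/(_ a): et; rewrite et' !mnmDE !mulmnE.
by move/addnI/eqP; rewrite eqn_pmul2r // => /eqP ->.
Qed.

Lemma module_term_emb (G H : graph) (f : embedding G H) t x :
  monotone f -> module_term t x -> module_term (push_mnm f t) (res_emb f x).
Proof.
move=> _ [i [g [m [-> ->]]]]; exists i, (emb_comp f g), (push_mnm f m).
rewrite push_mnmD push_mnmMn code_push; split=> //.
rewrite res_embZ emb_polyX; congr (_ *: _).
rewrite res_emb_comp; exact: res_mapU.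
Qed.

Lemma module_term_mul (G : graph) t x (m : 'X_{1..#|G|}) :
  module_term t x -> module_term (t + m *+ N)%MM (('X_[m] : poly_ring k G) *: x).
Proof.
move=> [i [f [m' [-> ->]]]]; exists i, f, (m' + m)%MM; split.
  by apply/mnmP => a; rewrite !(mnmDE, mulmnE) mulnDl addnA.
by rewrite scalerA mulrC mpolyXD.
Qed.

(* All vertices of [L i] occur as marks in [t], and each occurs once in [t'], so
   that no vertex outside the image of [f] is marked in [t']. *)
Lemma module_term_le (G H : graph) (f : embedding G H) t x t' x' :
  monotone f -> module_term t x -> module_term t' x' ->
  (forall v, le_mod N (t (enum_rank v)) (t' (enum_rank (f v)))) ->
  exists m, t' = (push_mnm f t + m *+ N)%MM.
Proof.
move=> _ [i [g [m [et _]]]] [j [g' [m' [et' _]]]] lt.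
apply: push_mnm_quotient => // w hw.
have cE v : code g' (enum_rank (f v)) = code g (enum_rank v).
  by have [_] := lt v; rewrite et et' !code_mod.
have [u0] := cograph_inhabited (cographP (L i)).
have [_ [_ /(congr1 (@tag _ _)) /= eij]] := code_match (cE (g u0)).
subst j; rewrite /dvdn et' code_mod code_out // => u ew.
have [u' [e /tagm_inj eu]] := code_match (cE (g u)).
by apply: (hw (g u)); rewrite e -eu.
Qed.

(** The Groebner theorem for these terms. Representability by terms is closed under combinations, so
    it is checked only on basis elements, which are terms with [m] equal to 0. *)
Lemma finitely_generated_free (S : forall G : cograph, res_mod k G q.+1 -> Prop) :
  noetherian k -> (forall G, submodule (@S G)) ->
  (forall (G H : cograph) (f : embedding G H) x, S G x -> S H (res_emb f x)) ->
  (forall (G : cograph) x, S G x -> free_on (orbit z (G := G)) x) ->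
  exists (n' : nat) (L' : 'I_n' -> cograph) (z' : forall i, res_mod k (L' i) q.+1),
    (forall i, S _ (z' i)) /\
    forall (G : cograph) x, S G x -> span (orbit z' (G := G)) x.
Proof.
move=> nk Ss Se Sf.
apply: (@finitely_generated k q.+1 N nk isT module_term module_term_fun
  module_term_emb module_term_mul module_term_le S Ss Se) => G x /Sf.
apply: (@free_on_ind _ _ _ (fun x : res_mod k G q.+1 => exists t, @below k q.+1 module_term G t x)).
  exact: (bounded_submodule module_term_mul).
move=> _ [i [f ->]].
apply: (@bounded_term _ _ _ G (code f)).
exists i, f, 0%MM; rewrite mpolyX0 scale1r; split=> //.
by apply/mnmP => a; rewrite mnmDE mulmnE mnm0E addn0.
Qed.

End ModuleTerms.

(** * Hereditary families of ideals *)

Section PolynomialTerms.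
Variable k : comNzRingType.

(** Codes are the exponent vectors themselves and are used with [N] equal to 1, so that no marks are
    present. *)
Definition poly_term (G : graph) (t : 'X_{1..#|G|}) (x : res_mod k G 0) : Prop :=
  x = 'X_[t] :> poly_ring k G.

Lemma finitely_generated_ideal (I : forall G : cograph, poly_ring k G -> Prop) :
  noetherian k -> (forall G : cograph, ideal (@I G)) -> hereditary I ->
  exists (n : nat) (L : 'I_n -> cograph) (z : forall i, res_mod k (L i) 0),
    (forall i, I (L i) (z i)) /\
    forall (G : cograph) x, I G x -> span (orbit z (G := G)) x.
Proof.
move=> nk Iid Ih.
have Bmul (G : graph) t x (m : 'X_{1..#|G|}) :
    poly_term t x -> poly_term (t + m *+ 1)%MM (('X_[m] : poly_ring k G) *: x).
  by move=> ->; rewrite /poly_term mulm1n addmC mpolyXD.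
apply: (@finitely_generated k 0 1 nk isT poly_term _ _ Bmul _ I Iid Ih).
- by move=> G t x y -> ->.
- by move=> G H f t x _ ->; apply: emb_polyX.
- move=> G H f t x t' x' _ _ _ h; apply: push_mnm_quotient => // w _; rewrite dvd1n.
- move=> G x _.
  have [_ S] := bounded_submodule Bmul G.
  (* The constant 1 is a term and generates the whole ring, so every polynomial is bounded. *)
  have [|s bs] := @bounded_term k 0%N poly_term G 0%MM (1 : poly_ring k G).
    by rewrite /poly_term mpolyX0.
  have := S x (1 : poly_ring k G) 0 (ex_intro _ s bs) (ex_intro _ s (below0 _ _)).
  by rewrite addr0 [_ *: _]mulr1.
Qed.

End PolynomialTerms.

(** * Finite generation of the syzygies *)

Section SyzygyGenerators.
Variables (k : comNzRingType) (I : forall G : cograph, poly_ring k G -> Prop).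
Hypotheses (noeth_k : noetherian k) (I_ideal : forall G : cograph, ideal (@I G)).
Hypothesis I_hered : hereditary I.

Local Notation V G := (poly_ring k G)^o.
Local Notation Z G q := (@res_syz _ (V G) (@I G) q).
Local Notation F G q := (@res_free _ (V G) (@I G) q).
Local Notation d G q := (@res_d _ (V G) q).
Local Notation J G := (@var_ideal k G).
Local Notation cycle G q := (@tor_cycle _ (V G) (@I G) (J G) q).
Local Notation boundary G q := (@tor_boundary _ (V G) (@I G) (J G) q).

Lemma res_emb_syz (G H : cograph) (f : embedding G H) q x :
  Z G q x -> Z H q (res_emb f x).
Proof. by apply: (res_map_syz (@emb_poly_semilinear k _ _ f)) => y; apply: I_hered. Qed.

Lemma res_emb_cycle (G H : cograph) (f : embedding G H) q x :
  cycle G q x -> cycle H q (@res_emb k _ _ f q.+1 x).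
Proof.
apply: (res_map_cycle (@emb_poly_semilinear k _ _ f)); first by move=> y; apply: I_hered.
by move=> a; apply: emb_poly_var_ideal.
Qed.

Lemma res_emb_d (G H : graph) (f : embedding G H) q (x : res_mod k G q.+1) :
  d H q (res_emb f x) = res_emb f (d G q x).
Proof. exact: (res_map_d (@emb_poly_semilinear k _ _ f)). Qed.

Lemma orbit_syz q n (L : 'I_n -> cograph) (z : forall i, res_mod k (L i) q) (G : cograph) y :
  (forall i, Z (L i) q (z i)) -> orbit z y -> Z G q y.
Proof. by move=> hz [i [f ->]]; apply: res_emb_syz. Qed.

Lemma orbit_free_emb q n (L : 'I_n -> cograph) (z : forall i, res_mod k (L i) q)
    (G H : graph) (f : embedding G H) (x : res_mod k G q.+1) :
  free_on (orbit z (G := G)) x -> free_on (orbit z (G := H)) (res_emb f x).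
Proof.
exact: (@res_map_free _ _ (V G) (V H) (@emb_poly k G H f) (@emb_poly k G H f) q
  (orbit z (G := G)) (orbit z (G := H)) (fun y => @orbit_emb k q n L z G H f y)).
Qed.

Lemma span_free_lift q (G : graph) (B : res_mod k G q -> Prop) x : span B x ->
  exists2 p : res_mod k G q.+1, free_on B p & d G q p = x.
Proof.
have ld := @res_d_linear _ (V G) q.
apply: (@span_min _ _ B (fun x => exists2 p : res_mod k G q.+1, free_on B p & d G q p = x)).
  split; first by exists 0; [apply: (submod0 (free_on_submodule _ _))|apply: (semilin0 ld)].
  move=> a y y' [p bp <-] [p' bp' <-]; exists (a *: p + p'); last exact: ld.
  by case: (free_on_submodule (poly_ring k G) B) => _; apply.
by move=> y By; exists << y >>; [apply: free_onU|apply: res_dU].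
Qed.

(** The invariant of the induction on [q]. The homotopy pushes syzygies into the span of the orbit
    and feeds the next degree; the second part says that this span meets every Tor class. *)
Definition orbit_complex (q n : nat) (L : 'I_n -> cograph)
    (z : forall i, res_mod k (L i) q) (G : cograph) : Prop :=
  (exists h : res_mod k G q.+1 -> res_mod k G q.+2,
     [/\ semilinear idfun h, forall x, F G q x -> F G q.+1 (h x)
       & forall x, Z G q.+1 x -> free_on (orbit z (G := G)) (x - d G q.+1 (h x))]) /\
  forall x, cycle G q x -> exists2 p, free_on (orbit z (G := G)) p & boundary G q (x - p).

(** The homotopy starts from [h'] equal to 0: elements of the ideal are already combinations of the
    orbit. *)
Lemma orbit_complex0 n (L : 'I_n -> cograph) (z : forall i, res_mod k (L i) 0) G :
  (forall i, Z (L i) 0 (z i)) ->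
  (forall x, I x -> span (orbit z (G := cograph_graph G)) x) -> orbit_complex z G.
Proof.
move=> hz hs.
have [| |x Ix|h [lh hF hB]] := @homotopy_step _ (V G) (@I G) 0 (orbit z (G := G)) (fun=> 0).
- by move=> y; apply: orbit_syz.
- by move=> a x y; rewrite scaler0 addr0.
- split; first exact: (submod0 (@free_on_submodule _ _ _)).
  have [p bp dp] := span_free_lift (hs x Ix); exists p => //.
  by rewrite (semilin0 (@res_d_linear _ (V G) 0)) subr0.
split; last first.
  apply: (cycle_homotopy (h' := fun=> 0) hF hB _) => x _.
  exact: (submod0 (@res_ideal_mul_submodule _ _ _ _ 0)).
exists h; split=> // x [fx _]; have := hB x fx; by rewrite subr0.
Qed.

Lemma orbit_complexS q n (L : 'I_n -> cograph) (z : forall i, res_mod k (L i) q)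
    n' (L' : 'I_n' -> cograph) (z' : forall i, res_mod k (L' i) q.+1) (G : cograph) :
  (forall i, Z (L' i) q.+1 (z' i)) ->
  (forall x : res_mod k G q.+1, free_on (orbit z (G := cograph_graph G)) x -> d G q x = 0 ->
     span (orbit z' (G := cograph_graph G)) x) ->
  orbit_complex z G -> orbit_complex z' G.
Proof.
move=> hz hs [[h' [lh' hF' hB']] _].
have [| |x zx|h [lh hF hB]] := @homotopy_step _ (V G) (@I G) q.+1 (orbit z' (G := G)) h'.
- by move=> y; apply: orbit_syz.
- exact: lh'.
- have [fx dx] := zx; split; first exact: hF'.
  have [|p bp dp] := span_free_lift (hs _ (hB' x zx) _); last by exists p.
  by rewrite (semilinB (@res_d_linear _ (V G) q)) dx (res_dd (hF' x fx)) subr0.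
have h0 : h' 0 = 0 := semilin0 lh'.
split; last first.
  apply: (cycle_homotopy (h' := h') hF hB _) => x [fx dx].
  exact: lin_ideal_mul.
exists h; split=> // x [fx dx]; have := hB x fx; by rewrite dx h0 subr0.
Qed.

Lemma finite_orbit_complex q : exists (n : nat) (L : 'I_n -> cograph)
    (z : forall i, res_mod k (L i) q),
  (forall i, Z (L i) q (z i)) /\ forall G, orbit_complex z G.
Proof.
elim: q => [|q [n [L [z [hz hG]]]]].
  have [n [L [z [hz hs]]]] := finitely_generated_ideal noeth_k I_ideal I_hered.
  by exists n, L, z; split=> // G; apply: orbit_complex0 => //; apply: hs.
(* The kernel of the differential on the free module on the orbit is hereditary, so it is finitely
   generated. *)
have [| | |n' [L' [z' [hz' hs']]]] := @finitely_generated_free k q n L z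
  (fun G x => free_on (orbit z (G := cograph_graph G)) x /\ d G q x = 0) noeth_k.
- move=> G; have S := free_on_submodule (poly_ring k G) (orbit z (G := G)).
  have ld := @res_d_linear _ (V G) q.
  split; first by split; [apply: (submod0 S)|apply: (semilin0 ld)].
  move=> a x y [bx dx] [by_ dy]; split; first by case: S => _; apply.
  by rewrite ld dx dy scaler0 addr0.
- move=> G H f x [bx dx]; split; first exact: orbit_free_emb.
  by rewrite res_emb_d dx (semilin0 (@res_emb_semilinear _ _ _ f q)).
- by move=> G x [].
have Zz' i : Z (L' i) q.+1 (z' i).
  by have [b e] := hz' i; split=> //; apply: free_on_mono b => y; apply: orbit_syz.
exists n', L', z'; split=> // G; apply: (@orbit_complexS q n L z) => // x bx dx.
exact: hs'.
Qed.

(* The coefficients of a combination of cycles only matter modulo the variables,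
   which turns generators over [poly_ring k G] into generators over [k]. *)
Lemma finite_tor q : exists (n : nat) (L : 'I_n -> cograph), forall G : cograph,
  tor_spanned_by I (fun y : tor_amb k G q =>
    exists (i : 'I_n) (f : embedding (L i) G) (z : tor_amb k (L i) q),
      ideal_tor_cycle I z /\ y = tor_map f z).
Proof.
have [n [L [z [hz hG]]]] := finite_orbit_complex q.
(* The submodule generated here consists of the Tor cycles inside the free module on the orbit. *)
have [| | |n' [L' [z' [hz' hs']]]] := @finitely_generated_free k q n L z
  (fun G x => free_on (orbit z (G := cograph_graph G)) x /\ cycle G q x) noeth_k.
- move=> G; have S := free_on_submodule (poly_ring k G) (orbit z (G := G)).
  have S' := @tor_cycle_submodule _ (V G) (@I G) (J G) q.
  split; first by split; [apply: (submod0 S)|apply: (submod0 S')].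
  by move=> a x y [bx cx] [by_ cy]; split; [case: S|case: S'] => _; apply.
- by move=> G H f x [bx cx]; split; [apply: orbit_free_emb|apply: res_emb_cycle].
- by move=> G x [].
exists n', L' => G x cx.
have [_ /(_ x cx) [p bp bxp]] := hG G.
have S' := @tor_cycle_submodule _ (V G) (@I G) (J G) q.
have cp : cycle G q p.
  by rewrite -(subKr x p); apply: (submodB S') => //; apply: boundary_cycle.
have [s hs ep] := hs' G p (conj bp cp).
exists [seq (a.1@_0%MM, a.2) | a <- s].
  move=> _ /mapP[a /hs [i [f ea]] ->]; exists i, f, (z' i); split=> //=.
  by case: (hz' i).
rewrite big_map; case: bxp => y fy jy; exists y => //.
(* The error made by replacing coefficients with their constant terms; it is a multiple of the
   variables and so does not change the class. *)
pose r : res_mod k G q.+1 := \sum_(a <- s) (a.1 - (a.1@_0%MM)%:MP) *: a.2.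
have -> : x - \sum_(a <- s) ((a.1@_0%MM)%:MP : poly_ring k G) *: a.2 - d G q.+1 y =
    (x - p - d G q.+1 y) + r.
  have -> : r = p - \sum_(a <- s) ((a.1@_0%MM)%:MP : poly_ring k G) *: a.2.
    by rewrite ep -sumrB; apply: eq_bigr => a _; rewrite scalerBl.
  by rewrite [RHS]addrAC addrA subrK.
have SJ := @res_ideal_mul_submodule _ (V G) (@I G) (J G) q.
apply: (submodD SJ) => //; apply: (submod_sum_seq SJ) => a /hs [i [f ea]].
apply: res_ideal_mulZ; last first.
  rewrite ea; apply: (res_map_res_free (@emb_poly_semilinear k _ _ f)) => [b|].
    exact: I_hered.
  have [b _] := hz' i; apply: free_on_mono b => w; exact: orbit_syz.
exact: poly_sub_const.
Qed.

End SyzygyGenerators.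

Lemma noetherian_field (k : fieldType) : noetherian k.
Proof.
move=> J [J0 JS]; case: (classic (exists2 a, J a & a != 0)) => [[a Ja a0]|H].
  exists [:: 1] => x; split=> _.
    exists [:: (x, 1)]; last by rewrite big_seq1 [_ *: _]mulr1.
    by move=> p; rewrite !inE => /eqP ->.
  have := JS (x / a) a 0 Ja J0.
  by rewrite addr0 [_ *: _]divfK.
exists [::] => x; split=> [Jx|[s hs ->]].
  exists [::] => //; rewrite big_nil; apply/eqP; apply: contraPT Jx => x0 Jx.
  by apply: H; exists x.
by case: s hs => [|p s] hs; [rewrite big_nil|have := hs p (mem_head _ _)].
Qed.

Theorem theorem2 :
  (forall (k : comNzRingType) (I : forall G : cograph, poly_ring k G -> Prop),
     noetherian k -> (forall G : cograph, ideal (I G)) -> hereditary I ->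
     exists (n : nat) (L : 'I_n -> cograph),
       forall gens : forall G : cograph, poly_ring k G -> Prop,
         (forall (G : cograph) (x : poly_ring k G),
            I G x <-> ideal_gen (gens G) x) ->
         forall (G : cograph) (x : poly_ring k G),
           I G x <->
           ideal_gen (fun y => exists (i : 'I_n) (f : embedding (L i) G)
                                 (z : poly_ring k (L i)),
                        gens (L i) z /\ y = emb_poly f z) x)
  /\
  (forall (k : fieldType) (I : forall G : cograph, poly_ring k G -> Prop),
     (forall G : cograph, ideal (I G)) -> hereditary I ->
     forall q : nat,
     exists (n : nat) (L : 'I_n -> cograph),
       forall G : cograph,
         tor_spanned_by I (fun y : tor_amb k G q =>
           exists (i : 'I_n) (f : embedding (L i) G) (z : tor_amb k (L i) q),
             ideal_tor_cycle I z /\ y = tor_map f z)).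
Proof.
split=> [k I nk Iid Ih|k I Iid Ih q]; last first.
  by apply: finite_tor => //; apply: noetherian_field.
have [n [L [z [hz hs]]]] := finitely_generated_ideal nk Iid Ih.
exists n, L => gens hg G x; split=> [/hs|]; last first.
  apply: span_min; first exact: Iid.
  move=> _ [i [f [y [gy ->]]]]; apply/Ih/hg; exact: span_gen.
apply: span_min; first exact: span_submodule.
(* Each [z i] is a combination of [gens (L i)], whichever generators were given; pushing it forward
   along [f] gives the image of [z i]. *)
move=> _ [i [f ->]]; have /hg := hz i.
apply: (span_semilin (@emb_poly_semilinear k _ _ f)); first exact: span_submodule.
by move=> y gy; apply: span_gen; exists i, f, y.
Qed.
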